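(* Let $(A,\mathfrak g,\omega)$ be a Lie-Rinehart algebra which is projective as a left $A$-module, and let $\{\chi_i,\varphi_i\}_{i\in I}$ be a dual basis of $\mathfrak g$. Then the symmetrisation map $\mathrm S\colon\mathcal S_A(\mathfrak g)\to\mathcal U_A(\mathfrak g)$, defined as the identity on $A=\mathcal S_A^0(\mathfrak g)$ and by $$\mathrm S(X_1\cdots X_k)=\frac1{k!}\sum_{j_1,\dots,j_k\in I}\ \sum_{\sigma\in\mathfrak S_k}\varphi_{j_1}(X_1)\cdots\varphi_{j_k}(X_k)\,\chi_{j_{\sigma(1)}}\cdots\chi_{j_{\sigma(k)}}$$ for $X_1,\dots,X_k\in\mathfrak g$, $k\ge1$, is a well-defined isomorphism of $A$-corings (in particular a bijective $A$-bimodule map).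
   Context: $\Bbbk$ a field of characteristic $0$, $A$ commutative. Lie-Rinehart algebra $(A,\mathfrak g,\omega)$: $\Bbbk$-Lie algebra and left $A$-module with Lie map $\omega\colon\mathfrak g\to\mathrm{Der}_\Bbbk(A)$, $\omega(aX)=a\omega(X)$, $[X,aY]=a[X,Y]+\omega(X)(a)Y$. A dual (projective) basis: $\chi_i\in\mathfrak g$, $\varphi_i\in\mathrm{Hom}_A(\mathfrak g,A)$ with $X=\sum_i\varphi_i(X)\chi_i$ (finitely many nonzero terms) for all $X$. $\mathcal U_A(\mathfrak g)$: universal enveloping algebra, universal $\Bbbk$-algebra with an algebra map $\iota_A\colon A\to\mathcal U_A(\mathfrak g)$ and a Lie map $\iota_{\mathfrak g}$ such that $\iota_{\mathfrak g}(aX)=\iota_A(a)\iota_{\mathfrak g}(X)$, $[\iota_{\mathfrak g}(X),\iota_A(a)]=\iota_A(\omega(X)(a))$; $A$ and $\mathfrak g$ are identified with their images. As $A$-corings: $\mathcal U_A(\mathfrak g)$ is an $A$-bimodule via left multiplication by $A$ on both sides (symmetric structure) with comultiplication $\Delta\colon\mathcal U_A(\mathfrak g)\to\mathcal U_A(\mathfrak g)\otimes_A\mathcal U_A(\mathfrak g)$, $\Delta(a)=a\otimes1$, $\Delta(X_1\cdots X_n)=\sum_{t=0}^n\sum_{\sigma\in W_{t,n-t}}X_{\sigma(1)}\cdots X_{\sigma(t)}\otimes X_{\sigma(t+1)}\cdots X_{\sigma(n)}$ ($W_{t,n-t}$ the $(t,n-t)$-shuffles) and counit $\varepsilon(a)=a$,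 $\varepsilon(X_1\cdots X_n)=0$ for $n\ge1$; $\mathcal S_A(\mathfrak g)$ is the symmetric $A$-algebra with the analogous (shuffle) coproduct making elements of $\mathfrak g$ primitive, and counit the projection to degree $0$. *)

(* Defs.v *)
From HB Require Import structures.
From mathcomp Require Import all_boot all_fingroup all_algebra.
Set Implicit Arguments.
Unset Strict Implicit.
Unset Printing Implicit Defensive.
Import GRing.Theory.
Local Open Scope ring_scope.

Section LieRinehartDefs.
Variables (K : fieldType) (A : comAlgType K) (g : lmodType A).

(* Lie-Rinehart algebra (A, g, omega): g is a K-Lie algebra (the K-structure
   being the one induced from the A-module structure via K -> A) and a left
   A-module; the anchor om : g -> Der_K(A) is A-linear and a Lie map, and the
   Leibniz rule [X, aY] = a[X,Y] + om X a Y holds. *)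
Record LieRinehart (br : g -> g -> g) (om : g -> A -> A) : Prop := {
  lr_brD_l : forall X Y Z, br (X + Y) Z = br X Z + br Y Z;
  lr_brD_r : forall X Y Z, br X (Y + Z) = br X Y + br X Z;
  lr_brZ_l : forall (c : K) X Y, br (c%:A *: X) Y = c%:A *: br X Y;
  lr_brZ_r : forall (c : K) X Y, br X (c%:A *: Y) = c%:A *: br X Y;
  lr_alt : forall X, br X X = 0;
  lr_jacobi : forall X Y Z, br X (br Y Z) + br Y (br Z X) + br Z (br X Y) = 0;
  lr_omD : forall X Y a, om (X + Y) a = om X a + om Y a;
  lr_omZ : forall (a : A) X b, om (a *: X) b = a * om X b;
  lr_der_add : forall X a b, om X (a + b) = om X a + om X b;
  lr_der_scale : forall X (c : K) a, om X (c *: a) = c *: om X a;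
  lr_der_leibniz : forall X a b, om X (a * b) = om X a * b + a * om X b;
  lr_om_lie : forall X Y a, om (br X Y) a = om X (om Y a) - om Y (om X a);
  lr_leibniz : forall X Y (a : A), br X (a *: Y) = a *: br X Y + om X a *: Y
}.

Definition LR_compatible (br : g -> g -> g) (om : g -> A -> A)
    (R : pzRingType) (iA : A -> R) (ig : g -> R) : Prop :=
  [/\ forall X Y, ig (X + Y) = ig X + ig Y,
      forall (a : A) X, ig (a *: X) = iA a * ig X,
      forall X Y, ig (br X Y) = ig X * ig Y - ig Y * ig X &
      forall X a, ig X * iA a - iA a * ig X = iA (om X a)].

Definition is_UEA (br : g -> g -> g) (om : g -> A -> A)
    (U : pzRingType) (iA : {rmorphism A -> U}) (ig : g -> U) : Prop :=
  LR_compatible br om iA ig /\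
  forall (R : pzRingType) (fA : {rmorphism A -> R}) (fg : g -> R),
    LR_compatible br om fA fg ->
    exists F : {rmorphism U -> R},
      [/\ forall a, F (iA a) = fA a,
          forall X, F (ig X) = fg X &
          forall G : {rmorphism U -> R},
            (forall a, G (iA a) = fA a) -> (forall X, G (ig X) = fg X) ->
            G =1 F].

Definition is_SymAlg (S : comAlgType A) (j : {linear g -> S}) : Prop :=
  forall (R : comAlgType A) (f : {linear g -> R}),
    exists F : {lrmorphism S -> R},
      (forall X, F (j X) = f X) /\
      forall G : {lrmorphism S -> R}, (forall X, G (j X) = f X) -> G =1 F.

Definition dual_basis (I : eqType) (chi : I -> g) (phi : I -> g -> A) : Prop :=
  [/\ forall i X Y, phi i (X + Y) = phi i X + phi i Y,
      forall i (a : A) X, phi i (a *: X) = a * phi i X &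
      forall X, exists s : seq I,
        [/\ uniq s, forall i, i \notin s -> phi i X = 0 &
            X = \sum_(i <- s) phi i X *: chi i]].

(* The symmetrisation formula on X_1 ... X_k, k >= 1; the sum over
   j_1, ..., j_k in I is taken over any finite duplicate-free list s of
   indices containing all i with phi_i(X_m) != 0. *)
Definition symm_formula (I : eqType) (chi : I -> g) (phi : I -> g -> A)
    (U : pzRingType) (iA : {rmorphism A -> U}) (ig : g -> U)
    (S : comAlgType A) (jS : {linear g -> S}) (Sym : S -> U) : Prop :=
  forall (k : nat) (X : 'I_k -> g) (s : seq I),
    (0 < k)%N -> uniq s -> (forall m i, phi i (X m) != 0 -> i \in s) ->
    Sym (\prod_(m < k) jS (X m)) =
      iA ((((k`!)%:R : K)^-1)%:A) *
      \sum_(J : {ffun 'I_k -> 'I_(size s)}) \sum_(sg : 'S_k)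
        iA (\prod_(m < k) phi (tnth (in_tuple s) (J m)) (X m)) *
        \prod_(m < k) ig (chi (tnth (in_tuple s) (J (sg m)))).

End LieRinehartDefs.

(* b : V -> V -> M is biadditive and A-balanced, where act is the action of
   A on V (the right action on the left factor coinciding with the left
   action, the bimodule structure being symmetric). *)
Definition balanced_biadd (A : Type) (V M : zmodType) (act : A -> V -> V)
    (b : V -> V -> M) : Prop :=
  [/\ forall u1 u2 v, b (u1 + u2) v = b u1 v + b u2 v,
      forall u v1 v2, b u (v1 + v2) = b u v1 + b u v2 &
      forall a u v, b (act a u) v = b u (act a v)].

Definition is_tensor (A : Type) (V T : zmodType) (act : A -> V -> V)
    (t : V -> V -> T) : Prop :=
  balanced_biadd act t /\
  forall (M : zmodType) (b : V -> V -> M), balanced_biadd act b ->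
    exists F : {additive T -> M},
      (forall u v, F (t u v) = b u v) /\
      forall G : {additive T -> M}, (forall u v, G (t u v) = b u v) -> G =1 F.

Definition shuffle (n t : nat) (s : 'S_n) : bool :=
  [forall i : 'I_n, forall j : 'I_n,
     ((i < j)%N && ((j < t)%N || (t <= i)%N)) ==> (s i < s j)%N].

Definition shuffle_coprod (R : pzRingType) (T : zmodType) (n : nat)
    (x : 'I_n -> R) (t : R -> R -> T) : T :=
  \sum_(p < n.+1) \sum_(s : 'S_n | shuffle p s)
     t (\prod_(m < n | (m < p)%N) x (s m)) (\prod_(m < n | (p <= m)%N) x (s m)).

Definition enveloping_coring (K : fieldType) (A : comAlgType K)
    (g : lmodType A) (R : pzRingType) (iA : A -> R) (ig : g -> R)
    (T : zmodType) (t : R -> R -> T) (D : {additive R -> T})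
    (e : {additive R -> A}) : Prop :=
  [/\ forall a, D (iA a) = t (iA a) 1,
      forall (n : nat) (X : 'I_n -> g), (0 < n)%N ->
        D (\prod_(m < n) ig (X m)) = shuffle_coprod (fun m => ig (X m)) t,
      forall a, e (iA a) = a &
      forall (n : nat) (X : 'I_n -> g), (0 < n)%N ->
        e (\prod_(m < n) ig (X m)) = 0].

(* Main.v *)
Require Import Defs.
From HB Require Import structures.
From mathcomp Require Import all_boot all_fingroup all_algebra.
From mathcomp Require Import boolp functions ring.
Set Implicit Arguments.
Unset Strict Implicit.
Unset Printing Implicit Defensive.
Import GRing.Theory.
Local Open Scope ring_scope.

(** Surjectivity is the usual filtration argument: [S(X_1 ... X_k)] equals
    [X_1 ... X_k] up to shorter words.  Well-definedness and injectivity rest on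
    the fact that both [X_1 ... X_k] in the symmetric algebra and its
    symmetrisation in [U] are combinations of monomials in the [chi_i] with the
    same coefficients [coefJ J (X_1 ... X_k)], which are symmetric multilinear
    forms in the [X_m].  So it suffices to see that these coefficients vanish on
    a combination that is zero in either algebra.

    In the symmetric algebra they are obtained by iterating the derivations
    extending [phi_i].  In [U] (the Poincare-Birkhoff-Witt part) one needs a
    left [A]-linear functional on [U] with prescribed value on the
    symmetrisation of top degree.  It is the matrix coefficient at the empty
    word of an action of [U] on the space of symmetric multilinear forms on [g],
    that is, of a flat connection [D] on this space with
    [(D_X f)(w) = - f(X w) + terms of lower order in f].  The connection is built
    by induction on the degree from the (neither flat nor torsion-free)
    connection [conn_X Y = \sum_i om_X(phi_i(Y)) chi_i] on [g]: the obstruction in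
    each degree is a cocycle of the Koszul complex by the Bianchi identity, and
    is killed by the explicit homotopy [1/(n+1) \sum_i], available in
    characteristic zero.

    Compatibility with the coproducts follows by induction from the recursion
    [k S(w) = \sum_(y in w) R_y (S (w \ y))], where
    [R_y u = \sum_i phi_i(y) u chi_i] is left [A]-linear, hence acts on the
    tensor square as a derivation. *)

(** * Sums over the letters of a word *)

Lemma perm_swap2 (T : eqType) (x y : T) w :
  perm_eq (x :: y :: w) (y :: x :: w).
Proof. by apply/seq.permP => p /=; rewrite addnCA. Qed.

Lemma perm_rem (T : eqType) (y : T) (w w' : seq T) :
  perm_eq w w' -> perm_eq (rem y w) (rem y w').
Proof.
move=> e; case: (boolP (y \in w)) => yw.
  have yw' : y \in w' by rewrite -(perm_mem e).
  rewrite -(perm_cons y); apply: perm_trans (perm_to_rem yw').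
  by rewrite perm_sym; apply: perm_trans (perm_to_rem yw); rewrite perm_sym.
by rewrite !rem_id // -(perm_mem e).
Qed.

(** [rem x (y :: z)] drops the head when [x] equals [y], which agrees with [y :: rem x z] only up to
    order; hence the invariance of [F] under permutations. *)
Lemma sum_rem_cons (T : eqType) (V : nmodType) (F : T -> seq T -> V) y z :
    (forall x u v, perm_eq u v -> F x u = F x v) ->
  \sum_(x <- y :: z) F x (rem x (y :: z)) =
  F y z + \sum_(x <- z) F x (y :: rem x z).
Proof.
move=> Fp; rewrite big_cons /= eqxx; congr (_ + _).
apply: eq_big_seq => x xz; apply: Fp.
by case: eqVneq => [->|//]; apply: perm_to_rem.
Qed.

(** Invariance is asked only on words one letter shorter than [w], so that forms symmetric in
    bounded degree can be used. *)
Lemma sum_rem_perm (T : eqType) (V : nmodType) (F : T -> seq T -> V) w w' :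
    (forall x u v, (size u).+1 = size w -> perm_eq u v -> F x u = F x v) ->
    perm_eq w w' ->
  \sum_(x <- w) F x (rem x w) = \sum_(x <- w') F x (rem x w').
Proof.
move=> Fp e; rewrite -(perm_big _ e).
apply: eq_big_seq => x xw; apply: Fp (perm_rem x e).
by rewrite size_rem // prednK //; case: (w) xw.
Qed.

Lemma size_remS (T : eqType) (y : T) w : y \in w -> (size (rem y w)).+1 = size w.
Proof. by move=> yw; rewrite size_rem // prednK //; case: (w) yw. Qed.

(** * A flat connection on symmetric multilinear forms *)

Section FlatConnection.
Variables (K : fieldType) (A : comAlgType K) (g : lmodType A).
Variables (br : g -> g -> g) (om : g -> A -> A).
Hypothesis Hchar : [pchar K] =i pred0.
Hypothesis HLR : LieRinehart br om.

Definition nat_inv n : A := ((n%:R : K)^-1)%:A.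

(** Characteristic zero enters here, through the invertibility of positive integers. *)
Lemma nat_invK n : (0 < n)%N -> nat_inv n * n%:R = 1.
Proof.
move=> n0; rewrite /nat_inv mulr_algl -(scaler_nat n 1) scalerA mulVf ?scale1r //.
by have /pcharf0P -> := Hchar; rewrite -lt0n.
Qed.

Lemma omB X a b : om X (a - b) = om X a - om X b.
Proof.
have om0 : om X 0 = 0 by apply: (addIr (om X 0)); rewrite -(lr_der_add HLR) !add0r.
have -> : om X (a - b) = om X (a - b) + om X b - om X b by rewrite addrK.
by rewrite -(lr_der_add HLR) subrK.
Qed.

Lemma brC X Y : br X Y = - br Y X.
Proof.
apply/eqP; rewrite -addr_eq0; apply/eqP.
have := lr_alt HLR (X + Y).
rewrite (lr_brD_l HLR) !(lr_brD_r HLR) !(lr_alt HLR) addr0 add0r.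
by [].
Qed.

Lemma br_scale_l a X Y : br (a *: X) Y = a *: br X Y - om Y a *: X.
Proof. by rewrite brC (lr_leibniz HLR) opprD -scalerN -brC. Qed.

Variable conn : g -> g -> g.
Hypothesis conn_add_l : forall X Y Z, conn (X + Y) Z = conn X Z + conn Y Z.
Hypothesis conn_scale_l : forall a X Z, conn (a *: X) Z = a *: conn X Z.
Hypothesis conn_add_r : forall X Y Z, conn X (Y + Z) = conn X Y + conn X Z.
Hypothesis conn_scale_r : forall a X Z,
  conn X (a *: Z) = a *: conn X Z + om X a *: Z.

(** The covariant derivative on forms induced by [conn] through the Leibniz rule. The differentiated
    letter is moved to the front, which is harmless on symmetric forms. *)
Definition nab X (f : seq g -> A) w : A :=
  om X (f w) - \sum_(y <- w) f (conn X y :: rem y w).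

Section Ops.
(* [Cop X Y f z] is the value that [(E_X - nab_X) f (Y z) - (E_Y - nab_Y) f (X z)]
   must have for [D_X f w = E_X f w - f (X w)] to be flat in degree [size z]. *)
Variable E : g -> (seq g -> A) -> seq g -> A.

Definition Dop X f w : A := E X f w - f (X :: w).

Definition Cop X Y f z : A :=
  Dop (br X Y) f z - E X (Dop Y f) z + E Y (Dop X f) z
  - nab X f (Y :: z) + nab Y f (X :: z).

End Ops.

(* [n] is fuel: the value at [w] is independent of [n] as soon as [size w <= n].
   The added sum is the Koszul homotopy applied to the obstruction. *)
Fixpoint En n : g -> (seq g -> A) -> seq g -> A :=
  if n is n'.+1 then
    fun X f w => nab X f w +
      nat_inv (size w).+1 * \sum_(y <- w) Cop (En n') X y f (rem y w)
  else nab.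

Definition E X f w := En (size w) X f w.
Notation D := (Dop E).
Notation C := (Cop E).

Lemma nab_ext X f f' w : (forall u, (size u <= size w)%N -> f u = f' u) ->
  nab X f w = nab X f' w.
Proof.
move=> e; rewrite /nab e //; congr (_ - _).
by apply: eq_big_seq => y yw; rewrite e //= size_remS.
Qed.

(** The obstruction at [z] reads [f] on at most one letter more than [z], and [E] only in degrees up
    to [size z]; this lets the recursion on the degree close. *)
Lemma Cop_ext E1 E2 X Y f f' z :
    (forall X h h' u, (size u <= size z)%N ->
      (forall v, (size v <= size u)%N -> h v = h' v) -> E1 X h u = E2 X h' u) ->
    (forall u, (size u <= (size z).+1)%N -> f u = f' u) ->
  Cop E1 X Y f z = Cop E2 X Y f' z.
Proof.
move=> eE ef.
have eD W u : (size u <= size z)%N -> Dop E1 W f u = Dop E2 W f' u.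
  move=> su; rewrite /Dop (eE _ _ f') // ?ef // => v sv.
  by apply: ef; rewrite (leq_trans sv) // (leq_trans su).
have eED W V : E1 V (Dop E1 W f) z = E2 V (Dop E2 W f') z.
  by apply: eE => // v sv; apply: eD.
rewrite /Cop eD // !eED.
by rewrite (nab_ext X (f' := f')) // (nab_ext Y (f' := f')).
Qed.

Lemma En_ext n m X f f' w : (size w <= n)%N -> (size w <= m)%N ->
  (forall u, (size u <= size w)%N -> f u = f' u) -> En n X f w = En m X f' w.
Proof.
elim: n m X f f' w => [|n IH] [|m] X f f' w /=.
- by move=> _ _; apply: nab_ext.
- by case: w => // _ _ /nab_ext->; rewrite big_nil mulr0 addr0.
- by case: w => // _ _ /nab_ext->; rewrite big_nil mulr0 addr0.
move=> sn sm e; rewrite (nab_ext _ e); congr (_ + _ * _).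
apply: eq_big_seq => y /size_remS yw; apply: Cop_ext.
  move=> Z h h' u su; apply: IH; apply: leq_trans su _; by rewrite -ltnS yw.
by move=> u; rewrite yw; apply: e.
Qed.

Lemma E_unfold X f w : E X f w =
  nab X f w + nat_inv (size w).+1 * \sum_(y <- w) C X y f (rem y w).
Proof.
rewrite {1}/E; case: w => [|x w]; first by rewrite /= big_nil mulr0 addr0.
rewrite [LHS]/=; congr (_ + _ * _).
apply: eq_big_seq => y /size_remS [yw]; apply: Cop_ext => // Z h h' u su.
by apply: En_ext; rewrite // -yw.
Qed.

Lemma size_ind (P : seq g -> Prop) :
  (forall w, (forall z, (size z < size w)%N -> P z) -> P w) -> forall w, P w.
Proof.
move=> H w; have [n] := ubnP (size w); elim: n w => // n IH w sw.
by apply: H => z sz; apply: IH; apply: leq_trans sz _; rewrite -ltnS.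
Qed.

Lemma nab_add X f f' h w :
  (forall u, (size u <= size w)%N -> h u = f u + f' u) ->
  nab X h w = nab X f w + nab X f' w.
Proof.
move=> e; rewrite /nab e // (lr_der_add HLR).
rewrite (eq_big_seq (fun y => f (conn X y :: rem y w) + f' (conn X y :: rem y w))).
  by rewrite big_split /=; ring.
by move=> y yw; rewrite e //= size_remS.
Qed.

Lemma nab_scale X a f h w :
  (forall u, (size u <= size w)%N -> h u = a * f u) ->
  nab X h w = a * nab X f w + om X a * f w.
Proof.
move=> e; rewrite /nab e // (lr_der_leibniz HLR).
rewrite (eq_big_seq (fun y => a * f (conn X y :: rem y w))).
  by rewrite -mulr_sumr; ring.
by move=> y yw; rewrite e //= size_remS.
Qed.

(** Stated for any [h] agreeing with the sum up to the degree of [w]: the induction applies it to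
    [Dop E y h], which is known to split only in lower degrees. *)
Lemma E_add X f f' h w :
  (forall u, (size u <= size w)%N -> h u = f u + f' u) ->
  E X h w = E X f w + E X f' w.
Proof.
move: w X f f' h; apply: size_ind => w IH X f f' h e.
rewrite !E_unfold (nab_add _ e) (_ : \sum_(y <- w) C X y h (rem y w) =
  \sum_(y <- w) C X y f (rem y w) + \sum_(y <- w) C X y f' (rem y w)); first by ring.
rewrite -big_split; apply: eq_big_seq => y /size_remS yw /=.
have eD W u : (size u < size w)%N -> D W h u = D W f u + D W f' u.
  move=> su; rewrite /Dop e // (IH u su W f f' h); first by ring.
  by move=> v sv; apply: e; apply: leq_trans sv (ltnW su).
rewrite /Cop eD -?yw // (IH _ _ X (D y f) (D y f')) -?yw //; last first.
  by move=> u su; apply: eD; rewrite -yw ltnS.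
rewrite (IH _ _ y (D X f) (D X f')) -?yw //; last first.
  by move=> u su; apply: eD; rewrite -yw ltnS.
rewrite (@nab_add X f f' h) ?(@nab_add y f f' h) //=; last 2 first.
- by move=> u; rewrite yw; apply: e.
- by move=> u; rewrite yw; apply: e.
by ring.
Qed.

Lemma D_add X f f' h w :
  (forall u, (size u <= (size w).+1)%N -> h u = f u + f' u) ->
  D X h w = D X f w + D X f' w.
Proof.
move=> e; rewrite /Dop e // (E_add X (f := f) (f' := f')); first by ring.
by move=> u su; apply: e; apply: leqW.
Qed.

Lemma E_sub X f f' h w :
  (forall u, (size u <= size w)%N -> h u = f u - f' u) ->
  E X h w = E X f w - E X f' w.
Proof.
move=> e; apply/eqP; rewrite eq_sym subr_eq; apply/eqP; apply: E_add => u su.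
by rewrite e // subrK.
Qed.

Lemma D_sub X f f' h w :
  (forall u, (size u <= (size w).+1)%N -> h u = f u - f' u) ->
  D X h w = D X f w - D X f' w.
Proof.
move=> e; rewrite /Dop e // (E_sub X (f := f) (f' := f')); first by ring.
by move=> u su; apply: e; apply: leqW.
Qed.

Lemma E_eq0 X f w :
  (forall u, (size u <= size w)%N -> f u = 0) -> E X f w = 0.
Proof.
move=> e; apply: (addIr (E X f w)); rewrite add0r -(E_add X (h := f)) // => u su.
by rewrite e // addr0.
Qed.

(** The correction is [A]-linear in the form: in [Cop X y] the first derivatives of [a] cancel, and
    the second ones cancel against [om (br X y) a]. Only [nab] contributes a derivative of [a]. *)
Lemma E_scale X a f h w :
  (forall u, (size u <= size w)%N -> h u = a * f u) ->
  E X h w = a * E X f w + om X a * f w.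
Proof.
move: w X a f h; apply: size_ind => w IH X a f h e.
rewrite !E_unfold (nab_scale _ e) (_ : \sum_(y <- w) C X y h (rem y w) =
  a * \sum_(y <- w) C X y f (rem y w)); first by ring.
rewrite mulr_sumr; apply: eq_big_seq => y /size_remS yw /=.
have eD W u : (size u < size w)%N -> D W h u = a * D W f u + om W a * f u.
  move=> su; rewrite /Dop e // (IH u su W a f h); first by ring.
  by move=> v sv; apply: e; apply: leq_trans sv (ltnW su).
have eED W V : E V (D W h) (rem y w) =
    a * E V (D W f) (rem y w) + om V a * D W f (rem y w)
    + om W a * E V f (rem y w) + om V (om W a) * f (rem y w).
  rewrite (E_add V (f := fun u => a * D W f u) (f' := fun u => om W a * f u)).
    rewrite (IH _ _ V a (D W f) (fun u => a * D W f u)) -?yw //.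
    by rewrite (IH _ _ V (om W a) f (fun u => om W a * f u)) -?yw //; ring.
  by move=> u su; apply: eD; rewrite -yw ltnS.
rewrite /Cop eD -?yw // !eED (lr_om_lie HLR).
rewrite (@nab_scale X a f h) ?(@nab_scale y a f h) //=; last 2 first.
- by move=> u; rewrite yw; apply: e.
- by move=> u; rewrite yw; apply: e.
by rewrite /Dop; ring.
Qed.

Lemma D_scale X a f w :
  D X (fun u => a * f u) w = a * D X f w + om X a * f w.
Proof. by rewrite /Dop (@E_scale X a f) //; ring. Qed.

(* Symmetric multilinear forms in all degrees at most [n]; linearity is only asked
   for the first letter, in view of the symmetry. *)
Definition symlin n (f : seq g -> A) : Prop :=
  [/\ forall w w', (size w <= n)%N -> perm_eq w w' -> f w = f w',
      forall X Y w, (size w < n)%N -> f (X + Y :: w) = f (X :: w) + f (Y :: w) &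
      forall a X w, (size w < n)%N -> f (a *: X :: w) = a * f (X :: w)].

Lemma symlin_le m n f : (m <= n)%N -> symlin n f -> symlin m f.
Proof.
move=> mn [h1 h2 h3]; split=> [w w' sw|X Y w sw|a X w sw].
- by apply: h1; apply: leq_trans mn.
- by apply: h2; apply: leq_trans mn.
- by apply: h3; apply: leq_trans mn.
Qed.

(** Linearity in a letter holds because the term in [om X a] from the Leibniz rule of [om X] cancels
    the one from [conn_scale_r]. *)
Lemma nab_symlin n X f : symlin n f -> symlin n (nab X f).
Proof.
move=> [fp fD fZ].
have fcons x y u v : (size u < n)%N -> perm_eq u v -> f (conn x y :: u) = f (conn x y :: v).
  by move=> su uv; apply: fp => //=; rewrite perm_cons.
have step y z : (size z < n)%N -> nab X f (y :: z) =
    om X (f (y :: z)) - f (conn X y :: z) - \sum_(x <- z) f (y :: conn X x :: rem x z).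
  move=> sz; rewrite /nab -addrA -opprD; congr (_ - _).
  rewrite big_cons /= eqxx; congr (_ + _); apply: eq_big_seq => x xz.
  apply: fp => /=; first by case: eqVneq => //= _; rewrite size_remS.
  case: eqVneq => [->|_]; last by exact: perm_swap2.
  have := perm_to_rem xz; rewrite -(perm_cons (conn X x)) => /perm_trans; apply.
  by exact: perm_swap2.
split.
- move=> w w' sw e; rewrite /nab (fp w w') //; congr (_ - _).
  apply: (sum_rem_perm (F := fun y z => f (conn X y :: z))) => // x u v su uv.
  by apply: fcons => //; rewrite su.
- move=> Y Z w sw; rewrite !step // fD // conn_add_r fD // (lr_der_add HLR).
  rewrite (eq_big_seq (fun x => f (Y :: conn X x :: rem x w) + f (Z :: conn X x :: rem x w))).
    by rewrite big_split /=; ring.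
  by move=> x xw; rewrite fD //= size_remS.
- move=> a Y w sw; rewrite !step // fZ // conn_scale_r fD // !fZ // (lr_der_leibniz HLR).
  rewrite (eq_big_seq (fun x => a * f (Y :: conn X x :: rem x w))).
    by rewrite -mulr_sumr; ring.
  by move=> x xw; rewrite fZ //= size_remS.
Qed.

Lemma nab_add_l n X Y f w : symlin n f -> (size w <= n)%N ->
  nab (X + Y) f w = nab X f w + nab Y f w.
Proof.
move=> [_ fD _] sw; rewrite /nab (lr_omD HLR).
rewrite (eq_big_seq (fun x => f (conn X x :: rem x w) + f (conn Y x :: rem x w))).
  by rewrite big_split /=; ring.
by move=> x xw; rewrite conn_add_l fD // size_remS.
Qed.

Lemma nab_scale_l n a X f w : symlin n f -> (size w <= n)%N ->
  nab (a *: X) f w = a * nab X f w.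
Proof.
move=> [_ _ fZ] sw; rewrite /nab (lr_omZ HLR).
rewrite (eq_big_seq (fun x => a * f (conn X x :: rem x w))).
  by rewrite -mulr_sumr; ring.
by move=> x xw; rewrite conn_scale_l fZ // size_remS.
Qed.


(** The three properties are carried through one induction: the tensoriality of [Cop], from which
    the next correction inherits them, uses all three in the previous degree. *)
Definition E_good n := forall f, symlin n f ->
  [/\ forall X, symlin n (E X f),
      forall X Y w, (size w <= n)%N -> E (X + Y) f w = E X f w + E Y f w &
      forall a X w, (size w <= n)%N -> E (a *: X) f w = a * E X f w].

Section GoodStep.
Variable m : nat.
Hypothesis IH : E_good m.
Variable f : seq g -> A.
Hypothesis sf : symlin m.+1 f.

(** [Dop] evaluates the form on one more letter, so the bound on the degree drops by one. *)
Lemma D_symlin X : symlin m (D X f).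
Proof.
have [fp fD fZ] := sf; have sf' := symlin_le (leqnSn m) sf.
have [/(_ X) [Ep ED EZ] _ _] := IH sf'.
have swap W (w : seq g) : perm_eq (X :: W :: w) (W :: X :: w).
  by exact: perm_swap2.
split=> [w w' sw e|Y Z w sw|a Y w sw]; rewrite /Dop.
- by rewrite (Ep w w') // (fp (X :: w) (X :: w')) // perm_cons.
- by rewrite ED // !(fp _ _ _ (swap _ w)) //= fD //; ring.
- by rewrite EZ // !(fp _ _ _ (swap _ w)) //= fZ //; ring.
Qed.

Lemma D_add_l X Y w : (size w <= m)%N -> D (X + Y) f w = D X f w + D Y f w.
Proof.
move=> sw; have [_ ED _] := IH (symlin_le (leqnSn m) sf).
by have [_ fD _] := sf; rewrite /Dop ED // fD //; ring.
Qed.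

Lemma D_scale_l a X w : (size w <= m)%N -> D (a *: X) f w = a * D X f w.
Proof.
move=> sw; have [_ _ EZ] := IH (symlin_le (leqnSn m) sf).
by have [_ _ fZ] := sf; rewrite /Dop EZ // fZ //; ring.
Qed.

Lemma D_opp_l X w : (size w <= m)%N -> D (- X) f w = - D X f w.
Proof. by move=> sw; rewrite -scaleN1r D_scale_l // mulN1r. Qed.

Lemma C_antisym X Y z : (size z <= m)%N -> C X Y f z = - C Y X f z.
Proof. by move=> sz; rewrite /Cop (brC X Y) D_opp_l //; ring. Qed.

Lemma C_perm X Y z z' : (size z <= m)%N -> perm_eq z z' ->
  C X Y f z = C X Y f z'.
Proof.
move=> sz e; have [Dp _ _] := D_symlin (br X Y).
have [/(_ X) [EXp _ _] _ _] := IH (D_symlin Y).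
have [/(_ Y) [EYp _ _] _ _] := IH (D_symlin X).
have [nX _ _] := nab_symlin X sf; have [nY _ _] := nab_symlin Y sf.
rewrite /Cop (Dp _ _ sz e) (EXp _ _ sz e) (EYp _ _ sz e).
by rewrite (nX (Y :: z) (Y :: z')) ?(nY (X :: z) (X :: z')) //= perm_cons.
Qed.

Lemma C_add_l X Y Z z : (size z <= m)%N ->
  C (X + Y) Z f z = C X Z f z + C Y Z f z.
Proof.
move=> sz; have [_ EDZ _] := IH (D_symlin Z); have [_ nD _] := nab_symlin Z sf.
rewrite /Cop (lr_brD_l HLR) D_add_l // EDZ // (nab_add_l _ _ sf) // nD //.
rewrite (E_add Z (f := D X f) (f' := D Y f)); first by ring.
by move=> u su; apply: D_add_l; apply: leq_trans sz.
Qed.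

(** The derivative [om Z a] produced by the bracket cancels the one that [E_scale] produces from
    [E Z (Dop X f)]. *)
Lemma C_scale_l a X Z z : (size z <= m)%N -> C (a *: X) Z f z = a * C X Z f z.
Proof.
move=> sz; have [_ _ EDZ] := IH (D_symlin Z); have [_ _ nD] := nab_symlin Z sf.
rewrite /Cop br_scale_l D_add_l // D_opp_l // !D_scale_l // EDZ //.
rewrite (nab_scale_l _ _ sf) // nD //.
rewrite (E_scale Z (a := a) (f := D X f)); first by ring.
by move=> u su; apply: D_scale_l; apply: leq_trans sz.
Qed.

Lemma C_cons_add X Y P Q z : (size z < m)%N ->
  C X Y f (P + Q :: z) = C X Y f (P :: z) + C X Y f (Q :: z).
Proof.
move=> sz; have [_ DD _] := D_symlin (br X Y).
have [/(_ X) [_ EX _] _ _] := IH (D_symlin Y).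
have [/(_ Y) [_ EY _] _ _] := IH (D_symlin X).
have nS W V : nab W f (V :: P + Q :: z) =
    nab W f (V :: P :: z) + nab W f (V :: Q :: z).
  have swap T : perm_eq (V :: T :: z) (T :: V :: z).
    by exact: perm_swap2.
  have [np nD _] := nab_symlin W sf; rewrite !(np _ _ _ (swap _)) //=.
  by apply: nD.
by rewrite /Cop DD // EX // EY // !nS; ring.
Qed.

Lemma C_cons_scale X Y a P z : (size z < m)%N ->
  C X Y f (a *: P :: z) = a * C X Y f (P :: z).
Proof.
move=> sz; have [_ _ DD] := D_symlin (br X Y).
have [/(_ X) [_ _ EX] _ _] := IH (D_symlin Y).
have [/(_ Y) [_ _ EY] _ _] := IH (D_symlin X).
have nS W V : nab W f (V :: a *: P :: z) = a * nab W f (V :: P :: z).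
  have swap T : perm_eq (V :: T :: z) (T :: V :: z).
    by exact: perm_swap2.
  have [np _ nD] := nab_symlin W sf; rewrite !(np _ _ _ (swap _)) //=.
  by apply: nD.
by rewrite /Cop DD // EX // EY // !nS; ring.
Qed.

Lemma C_add_r X Y Z z : (size z <= m)%N ->
  C Z (X + Y) f z = C Z X f z + C Z Y f z.
Proof.
move=> sz; rewrite C_antisym // C_add_l // (C_antisym X) // (C_antisym Y) //; ring.
Qed.

Lemma C_scale_r a X Z z : (size z <= m)%N -> C Z (a *: X) f z = a * C Z X f z.
Proof. move=> sz; rewrite C_antisym // C_scale_l // (C_antisym X) //; ring. Qed.

(** The Koszul homotopy applied to the obstruction, before division by [(size w).+1]. *)
Definition corr X w : A := \sum_(y <- w) C X y f (rem y w).

Lemma corr_perm X w w' : (size w <= m.+1)%N -> perm_eq w w' ->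
  corr X w = corr X w'.
Proof.
move=> sw e; apply: (sum_rem_perm (F := fun y z => C X y f z)) => // x u v su.
by apply: C_perm; rewrite -ltnS su.
Qed.

Lemma corr_cons X y z : (size z <= m)%N ->
  corr X (y :: z) = C X y f z + \sum_(x <- z) C X x f (y :: rem x z).
Proof.
move=> sz; rewrite /corr big_cons /= eqxx; congr (_ + _).
apply: eq_big_seq => x xz; apply: C_perm => //=.
  by case: eqVneq => //= _; rewrite size_remS.
by case: eqVneq => [->|//]; apply: perm_to_rem.
Qed.

Lemma corr_symlin X : symlin m.+1 (corr X).
Proof.
split=> [w w' sw e|Y Z w sw|a Y w sw].
- exact: corr_perm.
- rewrite !corr_cons // C_add_r //.
  rewrite (eq_big_seq (fun x => C X x f (Y :: rem x w) + C X x f (Z :: rem x w))).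
    by rewrite big_split /=; ring.
  by move=> x xw; rewrite C_cons_add // size_remS.
- rewrite !corr_cons // C_scale_r //.
  rewrite (eq_big_seq (fun x => a * C X x f (Y :: rem x w))).
    by rewrite -mulr_sumr; ring.
  by move=> x xw; rewrite C_cons_scale // size_remS.
Qed.

Lemma corr_add_l X Y w : (size w <= m.+1)%N ->
  corr (X + Y) w = corr X w + corr Y w.
Proof.
move=> sw; rewrite -big_split; apply: eq_big_seq => x xw /=.
by rewrite C_add_l // -ltnS size_remS.
Qed.

Lemma corr_scale_l a X w : (size w <= m.+1)%N ->
  corr (a *: X) w = a * corr X w.
Proof.
move=> sw; rewrite /corr mulr_sumr; apply: eq_big_seq => x xw /=.
by rewrite C_scale_l // -ltnS size_remS.
Qed.

End GoodStep.

Lemma E_goodP n : E_good n.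
Proof.
elim: n => [|m IH] f sf.
  have E0 X w : (size w <= 0)%N -> E X f w = nab X f w by case: w.
  split.
  - move=> X; split=> // w w' sw e; rewrite !E0 //; last by rewrite -(perm_size e).
    by have [np' _ _] := nab_symlin X sf; apply: np'.
  - by move=> X Y w sw; rewrite !E0 // (nab_add_l _ _ sf).
  - by move=> a X w sw; rewrite !E0 // (nab_scale_l _ _ sf).
have EE X w : E X f w = nab X f w + nat_inv (size w).+1 * corr f X w.
  exact: E_unfold.
split.
- move=> X; have [cp cD cZ] := corr_symlin IH sf X.
  have [np nD nZ] := nab_symlin X sf.
  split=> [w w' sw e|Y Z w sw|a Y w sw]; rewrite !EE /=.
  + by rewrite (np w w') // (cp w w') // (perm_size e).
  + by rewrite nD // cD //; ring.
  + by rewrite nZ // cZ //; ring.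
- move=> X Y w sw; rewrite !EE (nab_add_l _ _ sf) // (corr_add_l IH sf) //; ring.
- move=> a X w sw; rewrite !EE (nab_scale_l _ _ sf) // (corr_scale_l IH sf) //; ring.
Qed.

Definition sym_form f := forall n, symlin n f.

Lemma sym_formE f : sym_form f <->
  [/\ forall w w', perm_eq w w' -> f w = f w',
      forall X Y w, f (X + Y :: w) = f (X :: w) + f (Y :: w) &
      forall a X w, f (a *: X :: w) = a * f (X :: w)].
Proof.
split=> [H|[h1 h2 h3] n].
  split=> [w w' e|X Y w|a X w].
  - by have [h _ _] := H (size w); apply: h.
  - by have [_ h _] := H (size w).+1; apply: h.
  - by have [_ _ h] := H (size w).+1; apply: h.
by split=> *; [apply: h1 | apply: h2 | apply: h3].
Qed.

Lemma D_sym_form X f : sym_form f -> sym_form (D X f).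
Proof. by move=> H n; exact: (@D_symlin n (@E_goodP n) f (H n.+1) X). Qed.

Lemma D_addl X Y f w : sym_form f -> D (X + Y) f w = D X f w + D Y f w.
Proof. by move=> H; apply: (@D_add_l _ (@E_goodP (size w)) f (H _)). Qed.

Lemma D_scalel a X f w : sym_form f -> D (a *: X) f w = a * D X f w.
Proof. by move=> H; apply: (@D_scale_l _ (@E_goodP (size w)) f (H _)). Qed.

Lemma D_0l f w : sym_form f -> D 0 f w = 0.
Proof. by move=> H; rewrite -(scale0r 0) D_scalel // mul0r. Qed.

Definition curv X Y f z : A := D X (D Y f) z - D Y (D X f) z - D (br X Y) f z.

(** The leading term of the outer [Dop] evaluates the inner one on a longer word. Unfolding [E]
    there leaves the Koszul differential of the correction minus the obstruction, so flatness asks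
    the correction to be a primitive of [Cop]. *)
Lemma curvE X Y f z : sym_form f ->
  curv X Y f z = nat_inv (size z).+2 * (corr f X (Y :: z) - corr f Y (X :: z))
                 - C X Y f z.
Proof.
move=> /sym_formE [fp _ _].
have DE P Q : D P (D Q f) z = E P (D Q f) z - nab Q f (P :: z)
    - nat_inv (size z).+2 * corr f Q (P :: z) + f (Q :: P :: z).
  by rewrite {1}/Dop {2}/Dop (E_unfold Q) /corr /=; ring.
rewrite /curv !DE (fp _ _ (perm_swap2 X Y z)) /Cop.
set p1 := D _ f z; set p2 := E X _ z; set p3 := E Y _ z; ring.
Qed.

(* The operator identity sum_cyc [D_Z, curv(X, Y)] = sum_cyc curv([X, Y], Z),
   read in degree |w|, where only the leading term -curv X Y f (Z :: w) of
   D_Z (curv X Y f) survives. *)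
Lemma bianchi X Y Z f w : sym_form f ->
    (forall X Y f u, (size u <= size w)%N -> sym_form f -> curv X Y f u = 0) ->
  curv X Y f (Z :: w) + curv Y Z f (X :: w) + curv Z X f (Y :: w) = 0.
Proof.
move=> sf c0.
have cD P Q R : curv Q R f (P :: w) =
    D P (D (br Q R) f) w - D P (D Q (D R f)) w + D P (D R (D Q f)) w.
  have -> : curv Q R f (P :: w) = - D P (curv Q R f) w.
    by rewrite /Dop E_eq0 ?sub0r ?opprK // => u su; apply: c0.
  rewrite (D_sub P (f := fun z => D Q (D R f) z - D R (D Q f) z) (f' := D (br Q R) f)) //.
  by rewrite (D_sub P (f := D Q (D R f)) (f' := D R (D Q f))) //; ring.
have c3 P Q R : D P (D Q (D R f)) w = D Q (D P (D R f)) w + D (br P Q) (D R f) w.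
  apply/eqP; rewrite -subr_eq0 opprD addrA; apply/eqP.
  by apply: (c0 P Q (D R f)) => //; apply: D_sym_form.
have c2 P Q R : D P (D (br Q R) f) w = D (br Q R) (D P f) w + D (br P (br Q R)) f w.
  apply/eqP; rewrite -subr_eq0 opprD addrA; apply/eqP.
  exact: (c0 P (br Q R) f).
have J : D (br X (br Y Z)) f w =
    - D (br Y (br Z X)) f w - D (br Z (br X Y)) f w.
  apply/eqP; rewrite -subr_eq0 opprD !opprK addrA -!D_addl //.
  by rewrite (lr_jacobi HLR) D_0l.
rewrite !cD (c3 Z X Y) (c3 X Y Z) (c3 Y Z X) !c2 J.
ring.
Qed.

Lemma curv_eq0 X Y f z : sym_form f -> curv X Y f z = 0.
Proof.
move: z X Y f; apply: size_ind => z IH X Y f sf.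
have [fp _ _] := (sym_formE f).1 sf.
have Cp P Q u v : perm_eq u v -> C P Q f u = C P Q f v.
  by apply: (C_perm (@E_goodP (size u)) (sf _)).
have Ca P Q u : C P Q f u = - C Q P f u.
  by apply: (C_antisym (@E_goodP (size u)) (sf _)).
have cp P u v : perm_eq u v -> corr f P u = corr f P v.
  by apply: (corr_perm (@E_goodP (size u)) (sf _)).
(* In the cyclic sum the terms in [corr] cancel in pairs, so the Bianchi identity says that the
   obstruction itself is Koszul-closed. *)
have cyc x u : (size u < size z)%N -> C X x f (Y :: u) - C Y x f (X :: u) = C X Y f (x :: u).
  move=> su; have := bianchi X Y x sf (w := u).
  rewrite !curvE //= (cp X _ _ (perm_swap2 x Y u)) (cp Y _ _ (perm_swap2 x X u)).
  rewrite (cp x _ _ (perm_swap2 Y X u)) (Ca x X).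
  set k := nat_inv _; set c1 := corr _ _ _; set c2 := corr _ _ _; set c3 := corr _ _ _.
  set d1 := C _ _ _ _; set d2 := C _ _ _ _; set d3 := C _ _ _ _.
  move=> H; apply/eqP; rewrite -subr_eq0 -H; first by apply/eqP; ring.
  by move=> P Q h v sv sh; apply: IH => //; apply: leq_ltn_trans su.
rewrite curvE // !(@corr_cons (size z)) //; try exact: E_goodP.
(* Antisymmetry gives two copies of [C X Y f z] and closedness one more for each letter of [z]; the
   total [size z + 2] is the denominator of the correction at [Y :: z]. *)
have -> : C X Y f z + \sum_(x <- z) C X x f (Y :: rem x z) -
   (C Y X f z + \sum_(x <- z) C Y x f (X :: rem x z)) = (size z).+2%:R * C X Y f z.
  rewrite (Ca Y X) opprD opprK addrACA -sumrB.
  rewrite (eq_big_seq (fun=> C X Y f z)) => [|x xz]; last first.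
    rewrite cyc ?size_remS //; apply: Cp.
    by rewrite perm_sym; apply: perm_to_rem.
  by rewrite big_const_seq count_predT iter_addr_0 -mulr2n -mulrnDr mulr_natl.
by rewrite mulrA nat_invK // mul1r subrr.
Qed.

End FlatConnection.

(** * The action of the enveloping algebra *)

Section AddEnd.
Variable M : zmodType.

Definition additive_pred : {pred M -> M} :=
  fun f => `[< forall x y, f (x + y) = f x + f y >].

Fact additive_pred_zmod_closed : zmod_closed additive_pred.
Proof.
split=> [|f f' /asboolP hf /asboolP hf']; apply/asboolP => x y.
  by rewrite /= addr0.
by rewrite !fctE hf hf'; rewrite opprD addrACA.
Qed.

HB.instance Definition _ :=
  GRing.isZmodClosed.Build (M -> M) additive_pred additive_pred_zmod_closed.

(** An action of [U] on [M] is a ring map to [addEnd M], which is the form in which the universal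
    property of [U] provides it. *)
Record addEnd := AddEnd { aeval : M -> M; aevalP : aeval \in additive_pred }.

HB.instance Definition _ := [isSub for aeval].
HB.instance Definition _ := [Choice of addEnd by <:].
HB.instance Definition _ := [SubChoice_isSubZmodule of addEnd by <:].

Lemma aevalD (f : addEnd) x y : aeval f (x + y) = aeval f x + aeval f y.
Proof. by case: f => f /= /asboolP. Qed.

Fact comp_additive_pred (f f' : addEnd) : aeval f \o aeval f' \in additive_pred.
Proof. by apply/asboolP => x y /=; rewrite !aevalD. Qed.

Fact id_additive_pred : id \in additive_pred.
Proof. exact/asboolP. Qed.

Let one : addEnd := AddEnd id_additive_pred.
Let mul (f f' : addEnd) : addEnd := AddEnd (comp_additive_pred f f').

Lemma addEnd_eq (f f' : addEnd) : (forall x, aeval f x = aeval f' x) -> f = f'.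
Proof. by move=> e; apply/val_inj/funext. Qed.

Fact addEnd_mulA : associative mul. Proof. by move=> f1 f2 f3; apply: addEnd_eq. Qed.
Fact addEnd_mul1 : left_id one mul. Proof. by move=> f; apply: addEnd_eq. Qed.
Fact addEnd_mulr1 : right_id one mul. Proof. by move=> f; apply: addEnd_eq. Qed.
Fact addEnd_mulDl : left_distributive mul +%R.
Proof. by move=> f1 f2 f3; apply: addEnd_eq. Qed.
Fact addEnd_mulDr : right_distributive mul +%R.
Proof. by move=> f1 f2 f3; apply: addEnd_eq => x /=; rewrite aevalD. Qed.

HB.instance Definition _ :=
  GRing.Zmodule_isPzRing.Build addEnd addEnd_mulA addEnd_mul1 addEnd_mulr1 addEnd_mulDl addEnd_mulDr.

Lemma aevalM (f f' : addEnd) x : aeval (f * f') x = aeval f (aeval f' x).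
Proof. by []. Qed.

Lemma aeval_add (f f' : addEnd) x : aeval (f + f') x = aeval f x + aeval f' x.
Proof. by []. Qed.

Lemma aeval_sub (f f' : addEnd) x : aeval (f - f') x = aeval f x - aeval f' x.
Proof. by []. Qed.

End AddEnd.

Section SymForms.
Variables (K : fieldType) (A : comAlgType K) (g : lmodType A).

Definition sym_form_pred : {pred seq g -> A} := fun f => `[< sym_form f >].

Fact sym_form_zmod_closed : zmod_closed sym_form_pred.
Proof.
split=> [|f f' /asboolP /sym_formE[h1 h2 h3] /asboolP /sym_formE[h1' h2' h3']].
  by apply/asboolP/sym_formE; split=> *; rewrite /= ?addr0 ?mulr0.
apply/asboolP/sym_formE; split=> [w w' e|X Y w|a X w].
- by rewrite !fctE (h1 _ _ e) (h1' _ _ e).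
- by rewrite !fctE h2 h2' opprD addrACA.
- by rewrite !fctE h3 h3' mulrBr.
Qed.

HB.instance Definition _ :=
  GRing.isZmodClosed.Build (seq g -> A) sym_form_pred sym_form_zmod_closed.

Record symF := SymF { form : seq g -> A; formP : form \in sym_form_pred }.

HB.instance Definition _ := [isSub for form].
HB.instance Definition _ := [Choice of symF by <:].
HB.instance Definition _ := [SubChoice_isSubZmodule of symF by <:].

Lemma symF_eq (f f' : symF) : (forall w, form f w = form f' w) -> f = f'.
Proof. by move=> e; apply/val_inj/funext. Qed.

Lemma symFP (f : symF) : sym_form (form f).
Proof. by case: f => f /= /asboolP. Qed.

Definition mk_symF (f : seq g -> A) (sf : sym_form f) : symF := SymF (asboolT sf).

Lemma scale_sym_form (a : A) (f : seq g -> A) : sym_form f -> sym_form (fun w => a * f w).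
Proof.
move=> /sym_formE[h1 h2 h3]; apply/sym_formE; split=> [w w' e|X Y w|b X w].
- by rewrite (h1 _ _ e).
- by rewrite h2 mulrDr.
- by rewrite h3 mulrCA.
Qed.

Definition scaleF (a : A) : symF -> symF := fun f => mk_symF (scale_sym_form a (symFP f)).

Fact scaleF_additive a : scaleF a \in @additive_pred symF.
Proof.
apply/asboolP => f f'; apply: symF_eq => w /=; exact: mulrDr.
Qed.

Definition scale_end a : addEnd symF := AddEnd (scaleF_additive a).

Fact scale_end_is_zmod_morphism : zmod_morphism scale_end.
Proof. by move=> a b; apply: addEnd_eq => f; apply: symF_eq => w /=; apply: mulrBl. Qed.

Fact scale_end_is_monoid_morphism : monoid_morphism scale_end.
Proof.
split=> [|a b]; apply: addEnd_eq => f; apply: symF_eq => w /=; first exact: mul1r.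
by rewrite mulrA.
Qed.

HB.instance Definition _ :=
  GRing.isZmodMorphism.Build A (addEnd symF) scale_end scale_end_is_zmod_morphism.
HB.instance Definition _ :=
  GRing.isMonoidMorphism.Build A (addEnd symF) scale_end scale_end_is_monoid_morphism.

End SymForms.

Section Action.
Variables (K : fieldType) (A : comAlgType K) (g : lmodType A).
Variables (br : g -> g -> g) (om : g -> A -> A).
Hypothesis Hchar : [pchar K] =i pred0.
Hypothesis HLR : LieRinehart br om.
Variable conn : g -> g -> g.
Hypothesis conn_add_l : forall X Y Z, conn (X + Y) Z = conn X Z + conn Y Z.
Hypothesis conn_scale_l : forall a X Z, conn (a *: X) Z = a *: conn X Z.
Hypothesis conn_add_r : forall X Y Z, conn X (Y + Z) = conn X Y + conn X Z.
Hypothesis conn_scale_r : forall a X Z,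
  conn X (a *: Z) = a *: conn X Z + om X a *: Z.

Notation D := (Dop (E br om conn)).

Definition DF X (f : symF g) : symF g :=
  mk_symF (D_sym_form HLR conn_add_l conn_scale_l conn_add_r conn_scale_r X (symFP f)).

Fact DF_additive X : DF X \in @additive_pred (symF g).
Proof. by apply/asboolP => f f'; apply: symF_eq => w /=; apply: D_add. Qed.

Definition D_end X : addEnd (symF g) := AddEnd (DF_additive X).

(** The bracket relation is the vanishing of the curvature, and the commutation relation with [A] is
    the Leibniz rule [D_scale]. *)
Lemma D_end_compatible : LR_compatible br om (scale_end g) D_end.
Proof.
split=> [X Y|a X|X Y|X a]; apply: addEnd_eq => f; apply: symF_eq => w.
- rewrite aeval_add /=; apply: D_addl => //; exact: symFP.
- rewrite aevalM /=; apply: D_scalel => //; exact: symFP.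
- rewrite aeval_sub !aevalM /=; symmetry; apply/eqP; rewrite -subr_eq0; apply/eqP.
  by apply: (curv_eq0 Hchar) => //; exact: symFP.
- rewrite aeval_sub !aevalM /=.
  transitivity (D X (fun u => a * form f u) w - a * D X (form f) w) => //.
  by rewrite D_scale // addrAC subrr add0r.
Qed.

(** [Psi f u] lets [u] act on [f] and evaluates at the empty word. Since the rightmost factor acts
    first, right multiplication by [ig X] turns into [DF X] on the form. *)
Lemma UEA_functional (U : pzRingType) (iA : {rmorphism A -> U}) (ig : g -> U) :
    is_UEA br om iA ig ->
  exists Psi : symF g -> U -> A,
    [/\ forall f u v, Psi f (u + v) = Psi f u + Psi f v,
        forall f a u, Psi f (iA a * u) = a * Psi f u,
        forall f, Psi f 1 = form f [::] &
        forall f u X, Psi f (u * ig X) = Psi (DF X f) u].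
Proof.
move=> [_ /(_ (addEnd (symF g)) (scale_end g) D_end D_end_compatible)].
move=> [F [FA Fg _]]; exists (fun f u => form (aeval (F u) f) [::]); split.
- by move=> f u v; rewrite rmorphD.
- by move=> f a u; rewrite rmorphM FA aevalM.
- by move=> f; rewrite rmorph1.
- by move=> f u X; rewrite rmorphM Fg aevalM.
Qed.

Lemma DF_lead N X f w : (forall u, (size u <= N)%N -> form f u = 0) ->
  (size w <= N)%N -> form (DF X f) w = - form f (X :: w).
Proof.
move=> f0 sw; rewrite /= /Dop (E_eq0 HLR) ?sub0r // => u su; apply: f0.
exact: leq_trans sw.
Qed.

End Action.

(** * Induction principles from the universal properties *)

Section Generation.
Variables (K : fieldType) (A : comAlgType K) (g : lmodType A).

Section EnvelopingAlgebra.
Variables (br : g -> g -> g) (om : g -> A -> A).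
Variables (U : pzRingType) (iA : {rmorphism A -> U}) (ig : g -> U).
Hypothesis HU : is_UEA br om iA ig.
Variable P : U -> Prop.
Hypothesis P1 : P 1.
Hypothesis PB : forall u v, P u -> P v -> P (u - v).
Hypothesis PM : forall u v, P u -> P v -> P (u * v).
Hypothesis PA : forall a, P (iA a).
Hypothesis Pg : forall X, P (ig X).

Definition genU_pred : {pred U} := fun u => `[< P u >].

Fact genU_closed : subring_closed genU_pred.
Proof.
split=> [|u v /asboolP hu /asboolP hv|u v /asboolP hu /asboolP hv];
apply/asboolP; [exact: P1|exact: PB|exact: PM].
Qed.

HB.instance Definition _ := GRing.isSubringClosed.Build U genU_pred genU_closed.

Record genU := GenU { genU_val : U; genU_valP : genU_val \in genU_pred }.

HB.instance Definition _ := [isSub for genU_val].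
HB.instance Definition _ := [Choice of genU by <:].
HB.instance Definition _ := GRing.SubChoice_isSubPzRing.Build U genU_pred genU genU_closed.

Definition genA a : genU := GenU (asboolT (PA a)).
Definition geng X : genU := GenU (asboolT (Pg X)).

Fact genA_is_zmod_morphism : zmod_morphism genA.
Proof. by move=> a b; apply: val_inj; rewrite /= rmorphB. Qed.
Fact genA_is_monoid_morphism : monoid_morphism genA.
Proof.
by split=> [|a b]; apply: val_inj; rewrite /= ?rmorph1 ?rmorphM.
Qed.
HB.instance Definition _ :=
  GRing.isZmodMorphism.Build A genU genA genA_is_zmod_morphism.
HB.instance Definition _ :=
  GRing.isMonoidMorphism.Build A genU genA genA_is_monoid_morphism.

(** The universal property maps [U] to the subring cut out by [P]. Followed by the inclusion, this
    map fixes the generators, so it is the identity by uniqueness. *)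
Lemma UEA_ind u : P u.
Proof.
have [[h1 h2 h3 h4] univ] := HU.
have [|F [FA Fg _]] := univ genU genA geng.
  split=> [X Y|a X|X Y|X a]; apply: val_inj; rewrite /=.
  - exact: h1.
  - exact: h2.
  - exact: h3.
  - exact: h4.
have [G [_ _ uniqG]] := univ U iA ig (And4 h1 h2 h3 h4).
have e : (\val \o F) u = u.
  rewrite (uniqG (\val \o F : {rmorphism U -> U})).
  - by rewrite -(uniqG idfun).
  - by move=> a; rewrite /= FA.
  - by move=> X; rewrite /= Fg.
by rewrite -e; apply/asboolP; exact: (valP (F u)).
Qed.

End EnvelopingAlgebra.

Section SymmetricAlgebra.
Variables (S : comAlgType A) (jS : {linear g -> S}).
Hypothesis HS : is_SymAlg jS.
Variable P : S -> Prop.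
Hypothesis P1 : P 1.
Hypothesis PL : forall a u v, P u -> P v -> P (a *: u + v).
Hypothesis PM : forall u v, P u -> P v -> P (u * v).
Hypothesis Pg : forall X, P (jS X).

Definition genS_pred : {pred S} := fun u => `[< P u >].

Fact genS_closed : subalg_closed genS_pred.
Proof.
split=> [|a u v /asboolP hu /asboolP hv|u v /asboolP hu /asboolP hv];
apply/asboolP; [exact: P1|exact: PL|exact: PM].
Qed.

HB.instance Definition _ := GRing.isSubalgClosed.Build A S genS_pred genS_closed.

Record genS := GenS { genS_val : S; genS_valP : genS_val \in genS_pred }.

HB.instance Definition _ := [isSub for genS_val].
HB.instance Definition _ := [Choice of genS by <:].
HB.instance Definition _ := [SubChoice_isSubComNzRing of genS by <:].
HB.instance Definition _ := [SubZmodule_isSubLmodule of genS by <:].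
HB.instance Definition _ := [SubNzRing_SubLmodule_isSubLalgebra of genS by <:].
HB.instance Definition _ := [SubLalgebra_isSubAlgebra of genS by <:].

Definition genj X : genS := GenS (asboolT (Pg X)).

Fact genj_is_linear : linear genj.
Proof. by move=> a X Y; apply: val_inj; rewrite /= linearP. Qed.
HB.instance Definition _ := GRing.isLinear.Build A g genS *:%R genj genj_is_linear.

Definition genS_inc (x : genS) : S := \val x.

Fact genS_inc_is_linear : linear genS_inc.
Proof. by move=> a x y; rewrite /genS_inc linearP. Qed.
Fact genS_inc_is_monoid_morphism : monoid_morphism genS_inc.
Proof. by split=> [|x y]; rewrite /genS_inc ?rmorph1 ?rmorphM. Qed.
HB.instance Definition _ := GRing.isLinear.Build A genS S *:%R genS_inc genS_inc_is_linear.
HB.instance Definition _ :=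
  GRing.isMonoidMorphism.Build genS S genS_inc genS_inc_is_monoid_morphism.

Lemma SymAlg_ind u : P u.
Proof.
have [F [Fg _]] := HS (genj : {linear g -> genS}).
have [G [_ uniqG]] := HS jS.
have e : (genS_inc \o F) u = u.
  rewrite (uniqG (genS_inc \o F : {lrmorphism S -> S})).
    by rewrite -(uniqG idfun).
  by move=> X; rewrite /= Fg.
by rewrite -e; apply/asboolP; exact: (valP (F u)).
Qed.

End SymmetricAlgebra.

End Generation.

(** * Symmetrisation in terms of a dual basis *)

Section DualBasis.
Variables (K : fieldType) (A : comAlgType K) (g : lmodType A).
Variables (I : eqType) (chi : I -> g) (phi : I -> g -> A).
Hypothesis Hdb : dual_basis chi phi.

Definition supp X : seq I := sval (cid (let: And3 _ _ h := Hdb in h X)).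

Lemma suppP X : [/\ uniq (supp X), forall i, i \notin supp X -> phi i X = 0 &
  X = \sum_(i <- supp X) phi i X *: chi i].
Proof. by rewrite /supp; case: cid. Qed.

Definition covers (s : seq I) X := forall i, phi i X != 0 -> i \in s.

Lemma supp_covers X : covers (supp X) X.
Proof. by have [_ h _] := suppP X => i; apply: contraR => /h->. Qed.

(** Restricted to the indices with [phi i X != 0], any two covering lists are permutations of each
    other, so the chosen support can be replaced by a list common to several vectors. *)
Lemma sum_supp (V : nmodType) (F : I -> V) X s :
    uniq s -> covers s X -> (forall i, phi i X = 0 -> F i = 0) ->
  \sum_(i <- supp X) F i = \sum_(i <- s) F i.
Proof.
move=> us cs F0; have [ut _ _] := suppP X.
have r t : \sum_(i <- t) F i = \sum_(i <- [seq i <- t | phi i X != 0]) F i.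
  rewrite big_filter (bigID (fun i => phi i X != 0)) /= [X in _ + X]big1 ?addr0 //.
  by move=> i /negbNE/eqP/F0.
rewrite r [RHS]r; apply: perm_big; apply: uniq_perm; rewrite ?filter_uniq // => i.
rewrite !mem_filter; case: (boolP (phi i X != 0)) => //= h.
by rewrite (cs i h) (supp_covers h).
Qed.

Lemma phiD i X Y : phi i (X + Y) = phi i X + phi i Y.
Proof. by have [h _ _] := Hdb; apply: h. Qed.

Lemma phiZ i a X : phi i (a *: X) = a * phi i X.
Proof. by have [_ h _] := Hdb; apply: h. Qed.

Lemma common_cover (w : seq g) :
  exists s, uniq s /\ forall y, y \in w -> covers s y.
Proof.
exists (undup (flatten [seq supp y | y <- w])); split; first exact: undup_uniq.
move=> y yw i /supp_covers iy; rewrite mem_undup; apply/flattenP.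
by exists (supp y) => //; apply: map_f.
Qed.

Section BasisConnection.
Variables (br : g -> g -> g) (om : g -> A -> A).
Hypothesis HLR : LieRinehart br om.

(** The Grassmann connection of the dual basis: coordinatewise differentiation on the free module
    over [I], compressed to its direct summand [g]. *)
Definition dconn X Y : g := \sum_(i <- supp Y) om X (phi i Y) *: chi i.

Lemma om0 X : om X 0 = 0.
Proof. by have := omB HLR X 0 0; rewrite !subrr. Qed.

Lemma dconnE X Y s : uniq s -> covers s Y ->
  dconn X Y = \sum_(i <- s) om X (phi i Y) *: chi i.
Proof. by move=> us cs; apply: sum_supp => // i ->; rewrite om0 scale0r. Qed.

Lemma dconn_add_l X Y Z : dconn (X + Y) Z = dconn X Z + dconn Y Z.
Proof. by rewrite -big_split; apply: eq_bigr => i _; rewrite (lr_omD HLR) scalerDl. Qed.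

Lemma dconn_scale_l a X Z : dconn (a *: X) Z = a *: dconn X Z.
Proof. by rewrite scaler_sumr; apply: eq_bigr => i _; rewrite (lr_omZ HLR) scalerA. Qed.

Lemma dconn_add_r X Y Z : dconn X (Y + Z) = dconn X Y + dconn X Z.
Proof.
have [s [us cs]] := common_cover [:: Y + Z; Y; Z].
have e T : T \in [:: Y + Z; Y; Z] -> dconn X T = \sum_(i <- s) om X (phi i T) *: chi i.
  by move=> /cs; apply: dconnE.
rewrite !e ?inE ?eqxx ?orbT // -big_split.
by apply: eq_bigr => i _; rewrite phiD (lr_der_add HLR) scalerDl.
Qed.

Lemma dconn_scale_r a X Z : dconn X (a *: Z) = a *: dconn X Z + om X a *: Z.
Proof.
have [s [us cs]] := common_cover [:: a *: Z; Z].
have [_ _ {3}->] := suppP Z.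
have e T : T \in [:: a *: Z; Z] -> dconn X T = \sum_(i <- s) om X (phi i T) *: chi i.
  by move=> /cs; apply: dconnE.
rewrite !e ?inE ?eqxx ?orbT // (sum_supp us (cs Z _)) ?inE ?eqxx ?orbT //; last first.
  by move=> i ->; rewrite scale0r.
rewrite !scaler_sumr -big_split; apply: eq_bigr => i _.
by rewrite phiZ (lr_der_leibniz HLR) scalerDl !scalerA addrC.
Qed.

End BasisConnection.

(** The average, over all orderings of [w], of the product of the [phi] along [J], expanded along
    the first entry of [J]; it vanishes unless the lengths agree. *)
Fixpoint coefJ (J : seq I) (w : seq g) : A :=
  if J is i :: J' then
    nat_inv A (size J) * \sum_(y <- w) phi i y * coefJ J' (rem y w)
  else (w == [::])%:R.

Lemma coefJ_size J w : size w != size J -> coefJ J w = 0.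
Proof.
elim: J w => [|i J IH] w /=; first by rewrite size_eq0 => /negbTE->.
move=> sw; rewrite big1_seq ?mulr0 // => y /= yw; rewrite IH ?mulr0 //.
by rewrite -eqSS size_remS.
Qed.

Lemma coefJ_sym_form J : sym_form (coefJ J).
Proof.
apply/sym_formE; elim: J => [|i J [IHp IHD IHZ]].
  split=> [w w' e|X Y w|a X w] /=; rewrite ?addr0 ?mulr0 //.
  by rewrite -!size_eq0 (perm_size e).
pose F y z := phi i y * coefJ J z.
have Fp x u v : perm_eq u v -> F x u = F x v by rewrite /F => /IHp->.
have cE w : coefJ (i :: J) w = nat_inv A (size J).+1 * \sum_(y <- w) F y (rem y w).
  by [].
split=> [w w' e|X Y w|a X w]; rewrite !cE ?(sum_rem_cons _ _ Fp).
- by congr (_ * _); apply: sum_rem_perm e => x u v _; apply: Fp.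
- rewrite /F phiD; under eq_bigr do rewrite IHD mulrDr.
  by rewrite big_split /=; ring.
- rewrite /F phiZ; under eq_bigr do rewrite IHZ mulrCA.
  by rewrite -mulr_sumr; ring.
Qed.

(** All lengths up to [n] occur, so one list serves combinations of words of mixed length; [coefJ]
    vanishes on the surplus terms. *)
Fixpoint words (s : seq I) n : seq (seq I) :=
  if n is n'.+1 then [::] :: [seq i :: J | i <- s, J <- words s n'] else [:: [::]].

(* The symmetric algebra and the enveloping algebra are both instances of [Q];
   in the former [sym w] is just the product of [w]. *)
Section Symmetrisation.
Variables (Q : pzRingType) (iQ : {rmorphism A -> Q}) (cQ : I -> Q).

Definition Rop X u : Q := \sum_(i <- supp X) iQ (phi i X) * u * cQ i.

Lemma RopE X u s : uniq s -> covers s X ->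
  Rop X u = \sum_(i <- s) iQ (phi i X) * u * cQ i.
Proof. by move=> us cs; apply: sum_supp => // i ->; rewrite rmorph0 !mul0r. Qed.

Lemma RopD X u v : Rop X (u + v) = Rop X u + Rop X v.
Proof. by rewrite -big_split; apply: eq_bigr => i _; rewrite mulrDr mulrDl. Qed.

Lemma RopA X a u : Rop X (iQ a * u) = iQ a * Rop X u.
Proof.
rewrite mulr_sumr; apply: eq_bigr => i _; rewrite !mulrA.
by rewrite -!rmorphM (mulrC a).
Qed.

(** The permutations of the symmetrisation formula are grouped by their last factor, so that [1/k!]
    becomes one factor [1/k] per recursive call. *)
Fixpoint symn n (w : seq g) : Q :=
  if n is n'.+1 then iQ (nat_inv A n) * \sum_(y <- w) Rop y (symn n' (rem y w))
  else 1.

Definition sym w := symn (size w) w.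

Lemma sym0 : sym [::] = 1. Proof. by []. Qed.

Lemma symE w : w != [::] ->
  sym w = iQ (nat_inv A (size w)) * \sum_(y <- w) Rop y (sym (rem y w)).
Proof.
case: w => // x w _; rewrite /sym; congr (_ * _); apply: eq_big_seq => y yw.
by congr Rop; congr (symn _ _); move: (size_remS yw) => /= [->].
Qed.

Definition monJ (J : seq I) : Q := foldr (fun i u => u * cQ i) 1 J.

Lemma sym_expand n s w : uniq s -> (forall y, y \in w -> covers s y) ->
  (size w <= n)%N -> sym w = \sum_(J <- words s n) iQ (coefJ J w) * monJ J.
Proof.
move=> us; elim: n w => [|n IH] [|x w0] // cs sw.
- by rewrite big_seq1 /= rmorph1 mulr1.
- rewrite big_cons /= rmorph1 mulr1 big_allpairs_dep big1 ?addr0 // => i _.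
  by rewrite big1 // => J _; rewrite /= big_nil mulr0 rmorph0 mul0r.
move: sw cs; have: x :: w0 != [::] by [].
move: (x :: w0) => w wn sw cs.
rewrite symE // big_cons /= (negbTE wn) mulr0n rmorph0 mul0r add0r big_allpairs_dep /=.
transitivity (iQ (nat_inv A (size w)) * \sum_(y <- w) \sum_(i <- s)
   \sum_(J <- words s n) iQ (phi i y * coefJ J (rem y w)) * (monJ J * cQ i)).
  congr (_ * _); apply: eq_big_seq => y yw; rewrite (RopE _ us (cs y yw)).
  apply: eq_bigr => i _; rewrite (IH (rem y w)).
  - rewrite mulr_sumr mulr_suml; apply: eq_bigr => J _.
    by rewrite !mulrA -rmorphM -!mulrA.
  - by move=> z /mem_rem /cs.
  - by rewrite -ltnS size_remS.
rewrite exchange_big mulr_sumr; apply: eq_bigr => i _.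
rewrite exchange_big mulr_sumr; apply: eq_bigr => J _.
rewrite -mulr_suml mulrA; congr (_ * _); rewrite -rmorph_sum -rmorphM.
(* The recursion of [sym] divides by [size w] and that of [coefJ] by the length of the index word;
   where these differ the coefficient is zero. *)
have [e|e] := eqVneq (size J).+1 (size w); first by rewrite -e.
rewrite big1_seq ?mulr0 // => y /= yw.
by rewrite coefJ_size ?mulr0 // -eqSS size_remS // eq_sym.
Qed.

(** Formal combinations of words are common to the symmetric and the enveloping algebra, so
    relations in the two can be compared before any map between them exists. *)
Definition ev (v : seq (A * seq g)) : Q := \sum_(p <- v) iQ p.1 * sym p.2.

Lemma ev_cat v v' : ev (v ++ v') = ev v + ev v'.
Proof. by rewrite /ev big_cat. Qed.

Lemma ev_scale a v : ev [seq (a * p.1, p.2) | p <- v] = iQ a * ev v.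
Proof.
rewrite /ev big_map mulr_sumr; apply: eq_bigr => p _ /=.
by rewrite rmorphM mulrA.
Qed.

Lemma ev_eq0 v : (forall J, \sum_(p <- v) p.1 * coefJ J p.2 = 0) -> ev v = 0.
Proof.
move=> v0; have [s [us cs]] := common_cover (flatten [seq p.2 | p <- v]).
pose n := (\max_(p <- v) size p.2)%N.
transitivity (\sum_(p <- v) \sum_(J <- words s n)
    iQ (p.1 * coefJ J p.2) * monJ J).
  apply: eq_big_seq => p pv; rewrite (@sym_expand n s) //.
  - by rewrite mulr_sumr; apply: eq_bigr => J _; rewrite mulrA rmorphM.
  - by move=> y yp; apply: cs; apply/flattenP; exists p.2 => //; apply: map_f.
  - by rewrite /n (big_rem p pv) /= leq_maxl.
rewrite exchange_big big1 // => J _.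
by rewrite -mulr_suml -rmorph_sum v0 rmorph0 mul0r.
Qed.

End Symmetrisation.

Lemma form_supp f y z s : sym_form f -> uniq s -> covers s y ->
  f (y :: z) = \sum_(i <- s) phi i y * f (chi i :: z).
Proof.
move=> /sym_formE [_ fD fZ] us cs.
have [_ _ {1}->] := suppP y.
rewrite (sum_supp us cs) => [|i ->]; last by rewrite scale0r.
elim: s {us cs} => [|i s IH]; last by rewrite !big_cons fD fZ IH.
by rewrite !big_nil -(scale0r (0 : g)) fZ mul0r.
Qed.

(** * Functionals on the enveloping algebra detecting the top degree *)

Section Envelope.
Variables (br : g -> g -> g) (om : g -> A -> A).
Hypothesis Hchar : [pchar K] =i pred0.
Hypothesis HLR : LieRinehart br om.
Variables (U : pzRingType) (iA : {rmorphism A -> U}) (ig : g -> U).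
Hypothesis HU : is_UEA br om iA ig.

Notation symU := (sym iA (fun i => ig (chi i))).
Notation evU := (ev iA (fun i => ig (chi i))).

(** Peeling a last factor [chi i] off [symU w] replaces the form by [DF (chi i)] of it, whose
    leading part is minus the contraction with [chi i]. By symmetry of the form every letter
    contributes the same value, and the averaging factor restores [f w]. *)
Lemma top_functional n (f : seq g -> A) : sym_form f ->
    (forall w, (size w < n)%N -> f w = 0) ->
  exists Psi : U -> A,
    [/\ forall u v, Psi (u + v) = Psi u + Psi v,
        forall a u, Psi (iA a * u) = a * Psi u &
        forall w, (size w <= n)%N -> Psi (symU w) = (- 1) ^+ n * f w].
Proof.
have cl := (dconn_add_l HLR, dconn_scale_l HLR, dconn_add_r HLR, dconn_scale_r HLR).
have [Psi [PD PA P1 PX]] := UEA_functional Hchar HLR cl.1.1.1 cl.1.1.2 cl.1.2 cl.2 HU.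
move=> sf f0; exists (Psi (mk_symF sf)); split=> // w sw.
have -> : f w = form (mk_symF sf) w by [].
have {f0} : forall w, (size w < n)%N -> form (mk_symF sf) w = 0 by [].
(* The form is generalised, as each step of the induction on [n] trades it for its derivative, which
   vanishes below the next lower degree. *)
move: (mk_symF sf) => {sf} F; elim: n F w sw => [|n IH] F [|x w0] // sw f0.
- by rewrite P1 mul1r.
- by rewrite P1 f0 ?mulr0.
have: x :: w0 != [::] by [].
move: sw; move: (x :: w0) => w sw wn.
have Psum (T : Type) (r : seq T) G (H : symF g) :
    Psi H (\sum_(i <- r) G i) = \sum_(i <- r) Psi H (G i).
  apply: (big_morph (Psi H)) => //.
  by apply: (addIr (Psi H 0)); rewrite add0r -PD addr0.
rewrite symE // PA Psum.
transitivity (nat_inv A (size w) * \sum_(y <- w) (-1) ^+ n.+1 * form F w).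
  congr (_ * _); apply: eq_big_seq => y yw.
  rewrite Psum.
  transitivity (\sum_(i <- supp y) phi i y *
                 ((-1) ^+ n * - form F (chi i :: rem y w))).
    apply: eq_bigr => i _; rewrite -mulrA PA PX; congr (_ * _).
    have sr : (size (rem y w) <= n)%N by rewrite -ltnS size_remS.
    have DFl u : (size u <= n)%N -> form (DF HLR cl.1.1.1 cl.1.1.2 cl.1.2 cl.2 (chi i) F) u
        = - form F (chi i :: u) by apply: DF_lead.
    rewrite IH ?DFl // => u su; rewrite DFl; last exact: ltnW.
    by rewrite f0 ?oppr0.
  have [us _ _] := suppP y.
  have [fp _ _] := (sym_formE (form F)).1 (symFP F).
  rewrite (fp w (y :: rem y w)) ?perm_to_rem //.
  rewrite (form_supp _ (symFP F) us (@supp_covers y)) exprS mulN1r mulNr mulr_sumr.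
  by rewrite -sumrN; apply: eq_bigr => i _; ring.
rewrite big_const_seq count_predT iter_addr_0; set x1 := (X in X *+ _).
rewrite -(mulr_natl x1) mulrA nat_invK ?mul1r //; last by rewrite lt0n size_eq0.
Qed.

End Envelope.

End DualBasis.

(** * Derivations of the symmetric algebra *)

Section PolynomialAlgebra.
Variables (K : fieldType) (A : comAlgType K) (S : comAlgType A).

(* [{poly S}] seen as an [A]-algebra, as the universal property of [S] requires. *)
Definition polyA := {poly S}.
HB.instance Definition _ := GRing.ComNzRing.on polyA.

Definition scale_polyA (a : A) (p : polyA) : polyA := a%:A *: (p : {poly S}).

Fact scale_polyA_A a b p : scale_polyA a (scale_polyA b p) = scale_polyA (a * b) p.
Proof. by rewrite /scale_polyA scalerA -scalerAl mul1r scalerA. Qed.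
Fact scale_polyA_1 : left_id 1 scale_polyA.
Proof. by move=> p; rewrite /scale_polyA !scale1r. Qed.
Fact scale_polyA_Dr : right_distributive scale_polyA +%R.
Proof. by move=> a p q; rewrite /scale_polyA scalerDr. Qed.
Fact scale_polyA_Dl p : {morph scale_polyA^~ p : a b / a + b}.
Proof. by move=> a b; rewrite /scale_polyA !scalerDl. Qed.
HB.instance Definition _ := GRing.Zmodule_isLmodule.Build A polyA
  scale_polyA_A scale_polyA_1 scale_polyA_Dr scale_polyA_Dl.

Fact scale_polyA_Al (a : A) (p q : polyA) : a *: (p * q) = (a *: p) * q.
Proof. exact: scalerAl. Qed.
HB.instance Definition _ := GRing.Lmodule_isLalgebra.Build A polyA scale_polyA_Al.
HB.instance Definition _ := GRing.Lalgebra_isComAlgebra.Build A polyA.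

End PolynomialAlgebra.

Section SymAlgFunctionals.
Variables (K : fieldType) (A : comAlgType K) (g : lmodType A).
Variables (S : comAlgType A) (jS : {linear g -> S}).
Hypothesis HS : is_SymAlg jS.

(* d is read off the algebra map S -> S[t], X |-> X + t f(X) in degree 1. *)
Lemma SymAlg_derivation (f : {scalar g}) : exists d : S -> S,
  [/\ forall x y, d (x + y) = d x + d y, forall a x, d (a *: x) = a *: d x &
      forall w, d (\prod_(y <- w) jS y) =
                \sum_(y <- w) f y *: \prod_(z <- rem y w) jS z].
Proof.
pose h X : polyA S := (jS X)%:P + ((f X)%:A : S) *: 'X.
have h_lin : linear h.
  move=> a X Y; rewrite /h !linearP /= scalerDl.
  have -> u : a *: (u : polyA S) = (a%:A : S) *: (u : {poly S}) by [].
  rewrite polyCD scalerDr scalerA -scalerAl mul1r !scalerA addrACA scalerDl.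
  by rewrite -!scalerA -mul_polyC -[in RHS]mul_polyC -polyCM mulr_algl.
pose hl := GRing.isLinear.Build A g (polyA S) *:%R h h_lin.
pose hL : {linear g -> polyA S} := HB.pack h hl.
have [F [Fg _]] := HS hL.
exists (fun x => (F x : {poly S})`_1); split.
- by move=> x y; rewrite rmorphD coefD.
- move=> a x; rewrite linearZ /=.
  have -> : a *: F x = (a%:A : S) *: (F x : {poly S}) :> {poly S} by [].
  by rewrite coefZ mulr_algl.
move=> w.
(* The constant coefficient is carried along because the degree one coefficient of a product
   involves it. *)
suff [] : (F (\prod_(y <- w) jS y) : {poly S})`_0 = \prod_(y <- w) jS y /\
   (F (\prod_(y <- w) jS y) : {poly S})`_1 =
     \sum_(y <- w) f y *: \prod_(z <- rem y w) jS z by [].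
elim: w => [|y w [IH0 IH1]].
  by rewrite !big_nil rmorph1 !coefC.
rewrite (sum_rem_cons (F := fun y w => f y *: \prod_(z <- w) jS z)); last first.
  by move=> x u v uv; rewrite (perm_big _ uv).
rewrite !big_cons.
have -> x : F (jS y * x) = (((jS y)%:P + ((f y)%:A : S) *: 'X) * (F x : {poly S}) : {poly S}).
  by rewrite rmorphM; congr (_ * _); apply: Fg.
rewrite !coefM !big_ord_recl !big_ord0 /= !coefD !coefC !coefZ !coefX /=.
rewrite /bump /= IH0 IH1 !addr0 !mulr0 !mulr1 !addr0 add0r; split=> //.
rewrite mulr_algl addrC mulr_sumr; congr (_ + _); apply: eq_bigr => z _.
by rewrite big_cons scalerAr.
Qed.

End SymAlgFunctionals.

(** * Bijectivity *)

Section WordFiltration.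
Variables (K : fieldType) (A : comAlgType K) (g : lmodType A).
Variables (br : g -> g -> g) (om : g -> A -> A).
Variables (U : pzRingType) (iA : {rmorphism A -> U}) (ig : g -> U).
Hypothesis HU : is_UEA br om iA ig.

Lemma igD X Y : ig (X + Y) = ig X + ig Y.
Proof. by have [[h _ _ _] _] := HU; apply: h. Qed.

Lemma igZ a X : ig (a *: X) = iA a * ig X.
Proof. by have [[_ h _ _] _] := HU; apply: h. Qed.

Lemma ig_br X Y : ig (br X Y) = ig X * ig Y - ig Y * ig X.
Proof. by have [[_ _ h _] _] := HU; apply: h. Qed.

Lemma ig_om X a : ig X * iA a - iA a * ig X = iA (om X a).
Proof. by have [[_ _ _ h] _] := HU; apply: h. Qed.

Lemma ig_sum (T : Type) (r : seq T) (a : T -> A) (X : T -> g) :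
  ig (\sum_(i <- r) a i *: X i) = \sum_(i <- r) iA (a i) * ig (X i).
Proof.
elim: r => [|i r IH]; last by rewrite !big_cons igD igZ IH.
by rewrite !big_nil -(scale0r (0 : g)) igZ rmorph0 mul0r.
Qed.

Definition mon w : U := \prod_(y <- w) ig y.

Lemma mon_nil : mon [::] = 1.
Proof. by rewrite /mon big_nil. Qed.

Lemma mon_cons X w : mon (X :: w) = ig X * mon w.
Proof. by rewrite /mon big_cons. Qed.

Lemma mon_rcons X w : mon (rcons w X) = mon w * ig X.
Proof. by rewrite /mon -cats1 big_cat big_seq1. Qed.

(** The filtration of [U] by word length. The bound is strict, so that [low 0] contains only zero
    and inductions start there. *)
Definition low n (u : U) : Prop := exists v : seq (A * seq g),
  all (fun p => (size p.2 < n)%N) v /\ u = \sum_(p <- v) iA p.1 * mon p.2.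

Lemma low_0 n : low n 0.
Proof. by exists [::]; rewrite big_nil. Qed.

Lemma low_add n u v : low n u -> low n v -> low n (u + v).
Proof. by move=> [r [hr ->]] [t [ht ->]]; exists (r ++ t); rewrite all_cat hr ht big_cat. Qed.

Lemma low_mon n a w : (size w < n)%N -> low n (iA a * mon w).
Proof. by move=> sw; exists [:: (a, w)]; rewrite /= sw big_seq1. Qed.

Lemma low_sum n (T : eqType) (r : seq T) (F : T -> U) :
  (forall i, i \in r -> low n (F i)) -> low n (\sum_(i <- r) F i).
Proof.
move=> H; rewrite big_seq; elim/big_ind: _ => //; first exact: low_0.
by move=> u v; apply: low_add.
Qed.

Lemma low_map n m (T : U -> U) : {morph T : u v / u + v} ->
  (forall a w, (size w < n)%N -> low m (T (iA a * mon w))) ->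
  forall u, low n u -> low m (T u).
Proof.
move=> TD H u [v [/allP hv ->]].
have T0 : T 0 = 0 by apply: (addIr (T 0)); rewrite -TD !add0r.
by rewrite (big_morph T TD T0); apply: low_sum => p /hv sp; apply: H.
Qed.

Lemma low_le m n u : (m <= n)%N -> low m u -> low n u.
Proof.
move=> mn; apply: (low_map (T := idfun)) => // a w sw.
by apply: low_mon; apply: leq_trans mn.
Qed.

Lemma low_scale n a u : low n u -> low n (iA a * u).
Proof.
apply: (low_map (T := fun u => iA a * u)) => [u' v|b w sw]; first exact: mulrDr.
by rewrite mulrA -rmorphM; apply: low_mon.
Qed.

Lemma low_opp n u : low n u -> low n (- u).
Proof. by move=> /(low_scale (-1)); rewrite rmorphN1 mulN1r. Qed.

Lemma low_mulr n u X : low n u -> low n.+1 (u * ig X).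
Proof.
apply: (low_map (T := fun u => u * ig X)) => [u' v|b w sw]; first exact: mulrDl.
by rewrite -mulrA -mon_rcons; apply: low_mon; rewrite size_rcons.
Qed.

Lemma low_mull n u X : low n u -> low n.+1 (ig X * u).
Proof.
apply: (low_map (T := fun u => ig X * u)) => [u' v|b w sw]; first exact: mulrDr.
have -> : ig X * (iA b * mon w) = iA b * mon (X :: w) + iA (om X b) * mon w.
  by rewrite mon_cons -ig_om mulrBl !mulrA addrC subrK.
by apply: low_add; apply: low_mon => //; apply: ltnW.
Qed.

(** Moving [a] past a letter [X] costs a term in which [X] is replaced by the scalar [om X a]. *)
Lemma low_comm a w : low (size w) (mon w * iA a - iA a * mon w).
Proof.
elim: w => [|X w IH] /=; first by rewrite /mon big_nil mul1r mulr1 subrr; apply: low_0.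
have -> : mon (X :: w) * iA a - iA a * mon (X :: w) =
    ig X * (mon w * iA a - iA a * mon w) + iA (om X a) * mon w.
  rewrite mon_cons -ig_om mulrBr mulrBl !mulrA addrA subrK //.
by apply: low_add; [apply: low_mull | apply: low_mon].
Qed.

Lemma low_mulA n u a : low n u -> low n (u * iA a).
Proof.
apply: (low_map (T := fun u => u * iA a)) => [u' v|b w sw]; first exact: mulrDl.
have -> : iA b * mon w * iA a =
    iA b * (mon w * iA a - iA a * mon w) + iA (b * a) * mon w.
  by rewrite mulrBr rmorphM !mulrA subrK.
by apply: low_add; [apply/low_scale/(low_le (ltnW sw))/low_comm | apply: low_mon].
Qed.

(** Exchanging two neighbours costs a bracket, that is, a word one letter shorter. *)
Lemma low_front x w : x \in w -> low (size w) (mon w - mon (x :: rem x w)).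
Proof.
elim: w => // y w IH; rewrite inE /=.
have [->|nxy] /= := eqVneq x y; first by rewrite subrr => _; apply: low_0.
move=> xw.
have -> : mon (y :: w) - mon (x :: y :: rem x w) =
    ig y * (mon w - mon (x :: rem x w)) + iA 1 * mon (br y x :: rem x w).
  rewrite rmorph1 mul1r !mon_cons ig_br mulrBr mulrBl !mulrA.
  by rewrite addrA subrK.
apply: low_add; first exact/low_mull/IH.
by apply: low_mon => /=; rewrite -(size_remS xw).
Qed.

Lemma low_perm w w' : perm_eq w w' -> low (size w) (mon w - mon w').
Proof.
elim: w w' => [|x w IH] w' e.
  by have := perm_size e => /=/esym/size0nil->; rewrite subrr; apply: low_0.
have xw' : x \in w' by rewrite -(perm_mem e) mem_head.
have e' : perm_eq w (rem x w').
  by rewrite -(perm_cons x) (perm_trans e) // perm_to_rem.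
have -> : mon (x :: w) - mon w' = ig x * (mon w - mon (rem x w')) +
    - (mon w' - mon (x :: rem x w')).
  by rewrite !mon_cons mulrBr opprB addrA subrK.
apply: low_add; first exact/low_mull/IH.
by apply: low_opp; rewrite (perm_size e); apply: low_front.
Qed.

Lemma low_exhaustive u : exists n, low n u.
Proof.
have fM n u1 : low n u1 -> forall w, exists m, low m (u1 * mon w).
  move=> h w; elim: w n u1 h => [|X w IH] n u1 h.
    by exists n; rewrite /mon big_nil mulr1.
  by rewrite mon_cons mulrA; apply: IH (low_mulr _ h).
have fD u1 u2 : (exists n, low n u1) -> (exists n, low n u2) -> exists n, low n (u1 + u2).
  move=> [n1 h1] [n2 h2]; exists (maxn n1 n2); apply: low_add.
    exact: low_le (leq_maxl _ _) h1.
  exact: low_le (leq_maxr _ _) h2.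
move: u; apply: (UEA_ind HU).
- by exists 1%N, [:: (1, [::])]; rewrite big_seq1 rmorph1 /mon big_nil mulr1.
- by move=> u1 u2 h1 [n h2]; apply: fD => //; exists n; apply: low_opp.
- move=> u1 u2 [n h1] [m [v [_ ->]]]; rewrite mulr_sumr.
  elim: v => [|p v IH]; first by exists 0%N; rewrite big_nil; apply: low_0.
  rewrite big_cons; apply: fD IH; rewrite mulrA.
  exact: fM (low_mulA _ h1) _.
- by move=> a; exists 1%N, [:: (a, [::])]; rewrite big_seq1 /mon big_nil mulr1.
- by move=> X; exists 2, [:: (1, [:: X])]; rewrite big_seq1 rmorph1 /mon big_seq1 mul1r.
Qed.

End WordFiltration.

(** * The symmetrisation as a bijective map *)

Section Isomorphism.
Variables (K : fieldType) (A : comAlgType K) (g : lmodType A).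
Variables (br : g -> g -> g) (om : g -> A -> A).
Hypothesis Hchar : [pchar K] =i pred0.
Hypothesis HLR : LieRinehart br om.
Variables (I : eqType) (chi : I -> g) (phi : I -> g -> A).
Hypothesis Hdb : dual_basis chi phi.
Variables (U : pzRingType) (iA : {rmorphism A -> U}) (ig : g -> U).
Hypothesis HU : is_UEA br om iA ig.
Variables (S : comAlgType A) (jS : {linear g -> S}).
Hypothesis HS : is_SymAlg jS.

Notation symU := (sym Hdb iA (fun i => ig (chi i))).
Notation evU := (ev Hdb iA (fun i => ig (chi i))).
Notation symS := (sym Hdb (in_alg S) (fun i => jS (chi i))).
Notation evS := (ev Hdb (in_alg S) (fun i => jS (chi i))).
Notation RU := (Rop Hdb iA (fun i => ig (chi i))).
Notation mon := (mon ig).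
Notation low := (low iA ig).

(** In a commutative algebra every summand of the recursion is already the whole product, and the
    average of [size w] equal terms is that term. *)
Lemma symS_prod w : symS w = \prod_(y <- w) jS y.
Proof.
have [n] := ubnP (size w); elim: n w => // n IH [|x w0] sw; first by rewrite big_nil.
have: x :: w0 != [::] by []; move: (x :: w0) sw => w sw wn.
rewrite symE // (eq_big_seq (fun=> \prod_(z <- w) jS z)) => [|y yw].
  rewrite big_const_seq count_predT iter_addr_0 -(mulr_natl (\prod_(z <- w) _)).
  rewrite mulrA -(rmorph_nat (in_alg S)) -rmorphM nat_invK ?rmorph1 ?mul1r //.
  by rewrite lt0n size_eq0.
rewrite (perm_big _ (perm_to_rem yw)) big_cons /= IH; last first.
  by rewrite -ltnS size_remS.
have [_ _ {3}->] := suppP Hdb y; rewrite linear_sum mulr_suml.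
by apply: eq_bigr => i _; rewrite linearZ /= mulrAC mulr_algl.
Qed.

Lemma symS_span x : exists v, x = evS v.
Proof.
move: x; apply: (SymAlg_ind HS).
- by exists [:: (1, [::])]; rewrite /ev big_seq1 rmorph1 mul1r.
- move=> a u v [r ->] [t ->]; exists ([seq (a * p.1, p.2) | p <- r] ++ t).
  by rewrite ev_cat ev_scale /= mulr_algl.
- move=> u v [r ->] [t ->].
  exists [seq (p.1 * q.1, p.2 ++ q.2) | p <- r, q <- t].
  rewrite /ev big_allpairs_dep mulr_suml; apply: eq_bigr => p _.
  rewrite mulr_sumr; apply: eq_bigr => q _.
  by rewrite /= !symS_prod big_cat /= !mulr_algl -scalerAl -scalerAr scalerA.
- by move=> X; exists [:: (1, [:: X])]; rewrite /ev big_seq1 symS_prod big_seq1 rmorph1 mul1r.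
Qed.

Lemma coefJ_functional J : exists h : S -> A,
  [/\ forall x y, h (x + y) = h x + h y, forall a x, h (a *: x) = a * h x &
      forall w, h (\prod_(y <- w) jS y) = coefJ phi J w].
Proof.
elim: J => [|i J [h [hD hZ hE]]].
  (* The empty index word is read off by the augmentation of [S], the algebra map that kills [g]. *)
  pose z : g -> A^o := fun=> 0.
  have z_lin : linear z by move=> a X Y; rewrite /z scaler0 addr0.
  pose zl := GRing.isLinear.Build A g A^o *:%R z z_lin.
  pose zL : {linear g -> A^o} := HB.pack z zl.
  have [F [Fg _]] := HS zL; exists F; split.
  - by move=> x y; rewrite rmorphD.
  - by move=> a x; rewrite linearZ.
  move=> [|y w] /=; first by rewrite big_nil rmorph1.
  rewrite big_cons rmorphM.
  transitivity (0 * F (\prod_(z <- w) jS z)); last by rewrite mul0r.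
  by congr (_ * _); apply: Fg.
have phi_lin : linear (phi i : g -> A^o).
  by move=> a X Y; rewrite (phiD Hdb) (phiZ Hdb).
pose pl := GRing.isLinear.Build A g A^o *:%R (phi i : g -> A^o) phi_lin.
pose pL : {scalar g} := HB.pack (phi i : g -> A^o) pl.
have [d [dD dZ dE]] := SymAlg_derivation HS pL.
have h0 : h 0 = 0 by apply: (addIr (h 0)); rewrite -hD !add0r.
exists (fun x => nat_inv A (size J).+1 * h (d x)); split.
- by move=> x y; rewrite dD hD mulrDr.
- by move=> a x; rewrite dZ hZ mulrCA.
move=> w; rewrite dE (big_morph h hD h0) /=; congr (_ * _).
by apply: eq_bigr => y _; rewrite hZ hE.
Qed.

Lemma evS_coefJ v J : evS v = 0 -> \sum_(p <- v) p.1 * coefJ phi J p.2 = 0.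
Proof.
have [h [hD hZ hE]] := coefJ_functional J; move=> v0.
have h0 : h 0 = 0 by apply: (addIr (h 0)); rewrite -hD !add0r.
transitivity (h (evS v)); last by rewrite v0.
rewrite /ev (big_morph h hD h0); apply: eq_bigr => p _.
by rewrite /= mulr_algl hZ symS_prod hE.
Qed.

Lemma evS_evU v : evS v = 0 -> evU v = 0.
Proof. by move=> v0; apply: ev_eq0 => J; apply: evS_coefJ. Qed.

Lemma evU_evS v : evU v = 0 -> evS v = 0.
Proof.
have [n] : exists n, all (fun p => (size p.2 < n)%N) v.
  exists (\max_(p <- v) (size p.2).+1)%N; apply/allP => p pv.
  by rewrite (big_rem p pv) /= leq_max leqnn.
elim: n v => [|n IH] v /allP sv v0.
  by case: v sv {v0} => [|p v] sv; [rewrite /ev big_nil | have := sv p (mem_head _ _)].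
have cv (Q : pzRingType) (iQ : {rmorphism A -> Q}) cQ :
    ev Hdb iQ cQ v = ev Hdb iQ cQ [seq p <- v | size p.2 == n] +
                     ev Hdb iQ cQ [seq p <- v | size p.2 != n].
  by rewrite /ev (bigID (fun p => size p.2 == n)) /= !big_filter.
have top0 J : \sum_(p <- [seq p <- v | size p.2 == n]) p.1 * coefJ phi J p.2 = 0.
  rewrite big_filter.
  have [sJ|sJ] := eqVneq (size J) n; last first.
    by apply: big1 => p /eqP sp; rewrite coefJ_size ?mulr0 // sp eq_sym.
  have [||Psi [PD PA PE]] := top_functional Hdb Hchar HLR HU (n := n) (f := coefJ phi J).
  - exact: coefJ_sym_form Hdb J.
  - by move=> w sw; apply: coefJ_size; rewrite sJ neq_ltn sw.
  have P0 : Psi 0 = 0 by apply: (addIr (Psi 0)); rewrite -PD !add0r.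
  have: Psi (evU v) = 0 by rewrite v0.
  rewrite /ev (big_morph Psi PD P0) (eq_big_seq (fun p =>
    (-1) ^+ n * (p.1 * coefJ phi J p.2))) => [|p /sv sp]; last first.
    by rewrite PA PE // mulrCA.
  rewrite -mulr_sumr => /(congr1 ( *%R ((-1) ^+ n))).
  rewrite mulrA -expr2 sqrr_sign mul1r mulr0 => e0; rewrite -[RHS]e0.
  rewrite [RHS](bigID (fun p => size p.2 == n)) /= [X in _ = _ + X]big1 ?addr0 //.
  by move=> p sp; rewrite coefJ_size ?mulr0 // sJ.
have top (Q : pzRingType) (iQ : {rmorphism A -> Q}) cQ :
    ev Hdb iQ cQ [seq p <- v | size p.2 == n] = 0 by apply: ev_eq0.
rewrite cv top add0r; apply: IH; last by rewrite -v0 [RHS]cv top add0r.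
apply/allP => p; rewrite mem_filter => /andP[sp /sv].
by rewrite ltnS leq_eqVlt (negbTE sp).
Qed.

Lemma symU_mon w : low (size w) (symU w - mon w).
Proof.
have [n] := ubnP (size w); elim: n w => // n IH [|x w0] sw.
  by rewrite sym0 mon_nil subrr; apply: low_0.
have: x :: w0 != [::] by []; move: (x :: w0) sw => w sw wn.
have -> : symU w - mon w =
    iA (nat_inv A (size w)) * \sum_(y <- w) (RU y (symU (rem y w)) - mon w).
  rewrite sumrB mulrBr -symE // big_const_seq count_predT iter_addr_0.
  rewrite -(mulr_natl (mon w)) mulrA -(rmorph_nat iA) -rmorphM nat_invK //.
    by rewrite rmorph1 mul1r.
  by rewrite lt0n size_eq0.
apply/low_scale/low_sum => y yw; have sz := size_remS yw.
set z := rem y w in sz *.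
(* Three errors of lower length: the one of [symU z], known by induction; the one of moving the
   coefficients of [y] across [mon z]; and the one of bringing [y] back to its place. *)
have -> : RU y (symU z) - mon w = RU y (symU z - mon z) +
   (RU y (mon z) - mon (rcons z y)) + (mon (rcons z y) - mon w).
  have {1}-> : symU z = symU z - mon z + mon z by rewrite subrK.
  by rewrite RopD !addrA subrK.
have e : perm_eq (rcons z y) w.
  by rewrite perm_rcons perm_sym perm_to_rem.
apply: low_add; last by have := low_perm HU e; rewrite (perm_size e).
apply: low_add.
  rewrite -sz; apply: (low_map (n := size z)) (IH _ _) => [u v|a t st|].
  - exact: RopD.
  - by rewrite RopA; apply/low_scale/low_sum => i _; apply/low_mulr/low_mon.
  - by rewrite -ltnS sz.
have [_ _ {2}->] := suppP Hdb y.
rewrite mon_rcons (ig_sum HU) mulr_sumr -sumrB; apply: low_sum => i _.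
rewrite !mulrA -mulrBl -opprB mulNr -sz; apply/low_opp/low_mulr.
exact: (low_comm HU).
Qed.

Lemma evU_surj u : exists v, u = evU v.
Proof.
have [n] := low_exhaustive HU u; elim: n u => [|n IH] u [v [/allP sv ->]].
  by exists [::]; case: v sv => [|p v sv]; [rewrite /ev !big_nil | have := sv p (mem_head _ _)].
elim: v sv => [|p v IHv] sv; first by exists [::]; rewrite /ev !big_nil.
have [|r er] := IHv; first by move=> q qv; apply: sv; rewrite inE qv orbT.
have sp : (size p.2 <= n)%N by apply: (sv p (mem_head _ _)).
have [t et] := IH _ (low_le sp (symU_mon p.2)).
have ep : evU [:: p] = iA p.1 * symU p.2 by rewrite /ev big_seq1.
exists (p :: [seq (- p.1 * q.1, q.2) | q <- t] ++ r).
rewrite big_cons er -cat1s !ev_cat ev_scale -et ep rmorphN mulNr.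
by rewrite mulrBr opprB addrA (addrC (iA p.1 * symU p.2)) subrK.
Qed.

(** Evaluates in [U] a chosen combination of words representing [x]; independence of the choice is
    [symmetrisation_ev]. *)
Definition symmetrisation (x : S) : U := evU (sval (cid (symS_span x))).

Lemma symmetrisation_ev v : symmetrisation (evS v) = evU v.
Proof.
rewrite /symmetrisation; case: cid => r /= e.
apply/eqP; rewrite -subr_eq0; apply/eqP.
have d (Q : pzRingType) (iQ : {rmorphism A -> Q}) cQ :
    ev Hdb iQ cQ (r ++ [seq (- 1 * p.1, p.2) | p <- v]) = ev Hdb iQ cQ r - ev Hdb iQ cQ v.
  by rewrite ev_cat ev_scale rmorphN1 mulN1r.
by rewrite -d; apply: evS_evU; rewrite d e subrr.
Qed.

Lemma symmetrisationD x y : symmetrisation (x + y) = symmetrisation x + symmetrisation y.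
Proof.
have [[v ->] [v' ->]] := (symS_span x, symS_span y).
by rewrite -ev_cat !symmetrisation_ev ev_cat.
Qed.

Lemma symmetrisationZ a x : symmetrisation (a *: x) = iA a * symmetrisation x.
Proof.
have [v ->] := symS_span x; rewrite -mulr_algl -(ev_scale _ (in_alg S)).
by rewrite !symmetrisation_ev ev_scale.
Qed.

Lemma symmetrisation_prod w : symmetrisation (\prod_(y <- w) jS y) = symU w.
Proof.
have evw (Q : pzRingType) (iQ : {rmorphism A -> Q}) cQ :
    ev Hdb iQ cQ [:: (1, w)] = sym Hdb iQ cQ w.
  by rewrite /ev big_seq1 rmorph1 mul1r.
by rewrite -symS_prod -evw symmetrisation_ev evw.
Qed.

Lemma symmetrisation_bij : bijective symmetrisation.
Proof.
have inj : injective symmetrisation.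
  move=> x y; have [[v ->] [v' ->]] := (symS_span x, symS_span y).
  rewrite !symmetrisation_ev => e; apply/eqP; rewrite -subr_eq0; apply/eqP.
  have d (Q : pzRingType) (iQ : {rmorphism A -> Q}) cQ :
      ev Hdb iQ cQ (v ++ [seq (- 1 * p.1, p.2) | p <- v']) = ev Hdb iQ cQ v - ev Hdb iQ cQ v'.
    by rewrite ev_cat ev_scale rmorphN1 mulN1r.
  by rewrite -d; apply: evU_evS; rewrite d e subrr.
have surj u : exists x, symmetrisation x = u.
  by have [v ->] := evU_surj u; exists (evS v); apply: symmetrisation_ev.
have K' : cancel (fun u => sval (cid (surj u))) symmetrisation.
  by move=> u; case: cid.
by exists (fun u => sval (cid (surj u))) => // x; apply: inj; rewrite K'.
Qed.

End Isomorphism.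

(** * Shuffles and splittings of a word *)

(** The pairs of complementary subwords of [w], in a recursive form suited to induction on words:
    these are the terms of the shuffle coproduct. *)
Fixpoint splits (T : Type) (w : seq T) : seq (seq T * seq T) :=
  if w is x :: w' then
    [seq (x :: p.1, p.2) | p <- splits w'] ++ [seq (p.1, x :: p.2) | p <- splits w']
  else [:: ([::], [::])].

Section Splits.
Variable V : nmodType.

Lemma sum_splits_cons (T : Type) (x : T) w (H : seq T * seq T -> V) :
  \sum_(p <- splits (x :: w)) H p =
  \sum_(p <- splits w) H (x :: p.1, p.2) + \sum_(p <- splits w) H (p.1, x :: p.2).
Proof. by rewrite big_cat !big_map. Qed.

Lemma sum_splits_rcons (T : Type) (x : T) w (H : seq T * seq T -> V) :
  \sum_(p <- splits (rcons w x)) H p =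
  \sum_(p <- splits w) (H (rcons p.1 x, p.2) + H (p.1, rcons p.2 x)).
Proof.
elim: w H => [|y w IH] H; first by rewrite sum_splits_cons !big_seq1.
by rewrite rcons_cons !sum_splits_cons !IH.
Qed.

Lemma sum_splits_map (T T' : Type) (f : T -> T') w (H : seq T' * seq T' -> V) :
  \sum_(p <- splits (map f w)) H p =
  \sum_(p <- splits w) H (map f p.1, map f p.2).
Proof.
elim: w H => [|y w IH] H; first by rewrite !big_seq1.
by rewrite map_cons !sum_splits_cons !IH.
Qed.

Lemma sum_splits_cat (T : Type) w1 w2 (H : seq T * seq T -> V) :
  \sum_(p <- splits (w1 ++ w2)) H p =
  \sum_(p <- splits w1) \sum_(q <- splits w2) H (p.1 ++ q.1, p.2 ++ q.2).
Proof.
elim: w1 H => [|y w IH] H; first by rewrite big_seq1; apply: eq_bigr => -[].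
by rewrite cat_cons !sum_splits_cons !IH.
Qed.

Lemma sum_splits_swap (T : Type) w (H : seq T * seq T -> V) :
  \sum_(p <- splits w) H p = \sum_(p <- splits w) H (p.2, p.1).
Proof.
elim: w H => [|y w IH] H; first by rewrite !big_seq1.
by rewrite !sum_splits_cons addrC; congr (_ + _); rewrite IH.
Qed.

Lemma size_splits (T : eqType) (w : seq T) p :
  p \in splits w -> (size p.1 + size p.2)%N = size w.
Proof.
elim: w p => [|y w IH] p; first by rewrite inE => /eqP->.
by rewrite mem_cat => /orP[] /mapP[q /IH sq ->] /=; rewrite ?addSn ?addnS sq.
Qed.

Lemma sum_splits_perm (T : eqType) (w w' : seq T) (H : seq T -> seq T -> V) :
    (forall p p' q q', perm_eq p p' -> perm_eq q q' -> H p q = H p' q') ->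
    perm_eq w w' ->
  \sum_(p <- splits w) H p.1 p.2 = \sum_(p <- splits w') H p.1 p.2.
Proof.
move=> Hp; pose F w := \sum_(p <- splits w) H p.1 p.2; rewrite -/(F w) -/(F w').
(* Permutations are generated by exchanges of adjacent blocks, and on a concatenation the sum
   factors over the blocks. *)
apply: (catCA_perm_subst (F := F)) => s1 s2 s3; rewrite /F !catA.
rewrite !(sum_splits_cat (_ ++ _)) !sum_splits_cat exchange_big /=.
do 3!apply: eq_bigr => ? _.
by apply: Hp; rewrite perm_cat2r perm_catC.
Qed.

(** Both sides run over a distinguished letter and a distribution of the others; on the left that
    letter belongs to the first subword. *)
Lemma sum_splits_rem_l (T : eqType) (w : seq T) (G : T -> seq T -> seq T -> V) :
    (forall y p p' q q', perm_eq p p' -> perm_eq q q' -> G y p q = G y p' q') ->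
  \sum_(p <- splits w) \sum_(y <- p.1) G y (rem y p.1) p.2 =
  \sum_(y <- w) \sum_(p <- splits (rem y w)) G y p.1 p.2.
Proof.
elim: w G => [|x w IH] G Gp; first by rewrite big_seq1 !big_nil.
rewrite sum_splits_cons.
have rc p q : \sum_(y <- x :: p) G y (rem y (x :: p)) q =
    G x p q + \sum_(y <- p) G y (x :: rem y p) q.
  by apply: (sum_rem_cons (F := fun y p => G y p q)) => y u v uv; apply: Gp.
under eq_bigr => p _ do rewrite rc.
rewrite big_split -addrA.
rewrite (sum_rem_cons (F := fun y z => \sum_(p <- splits z) G y p.1 p.2)); last first.
  by move=> y u v uv; apply: sum_splits_perm => // *; apply: Gp.
congr (_ + _).
under [RHS]eq_bigr => y _ do rewrite sum_splits_cons.
rewrite big_split /=; congr (_ + _).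
  apply: (IH (fun y p q => G y (x :: p) q)) => y p p' q q' e e'.
  by apply: Gp => //; rewrite perm_cons.
apply: (IH (fun y p q => G y p (x :: q))) => y p p' q q' e e'.
by apply: Gp => //; rewrite perm_cons.
Qed.

Lemma sum_splits_rem_r (T : eqType) (w : seq T) (G : T -> seq T -> seq T -> V) :
    (forall y p p' q q', perm_eq p p' -> perm_eq q q' -> G y p q = G y p' q') ->
  \sum_(p <- splits w) \sum_(y <- p.2) G y p.1 (rem y p.2) =
  \sum_(y <- w) \sum_(p <- splits (rem y w)) G y p.1 p.2.
Proof.
move=> Gp; rewrite sum_splits_swap.
rewrite (@sum_splits_rem_l _ w (fun y p q => G y q p)); last by move=> *; apply: Gp.
by apply: eq_bigr => y _; rewrite sum_splits_swap.
Qed.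

(** On a duplicate-free word a splitting amounts to the set of letters sent to the left; the sets
    with and without the head [x] match the two halves of the recursion. *)
Lemma sum_splits_sets (T : finType) (r : seq T) (H : seq T -> seq T -> V) :
  uniq r -> \sum_(p <- splits r) H p.1 p.2 =
  \sum_(B : {set T} | B \subset r) H [seq m <- r | m \in B] [seq m <- r | m \notin B].
Proof.
elim: r H => [|x r IH] H /=.
  move=> _; rewrite big_seq1 (big_pred1 set0) // => B.
  by apply/subsetP/eqP => [h|-> y]; [apply/setP => y; rewrite inE; apply/negP => /h | rewrite inE].
move=> /andP[xr ur]; rewrite sum_splits_cons.
rewrite (IH (fun p q => H (x :: p) q) ur) (IH (fun p q => H p (x :: q)) ur).
rewrite [RHS](bigID (fun B : {set T} => x \in B)) /=; congr (_ + _); last first.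
  apply: eq_big => [B|B Br].
    apply/idP/andP => [Br|[Br xB]].
      split; first by apply: subset_trans Br _; apply/subsetP => y; rewrite inE orbC => ->.
      by apply: contra xr => /(subsetP Br).
    apply/subsetP => y yB; have := subsetP Br y yB; rewrite inE => /orP[/eqP e|//].
    by rewrite -e yB in xB.
  suff -> : x \in B = false by [].
  by apply/negbTE; apply: contra xr => /(subsetP Br).
rewrite [RHS](reindex_onto (fun B : {set T} => x |: B) (fun B => B :\ x)) /=; last first.
  by move=> B /andP[_ xB]; rewrite setD1K.
apply: eq_big => [B|B Br].
  rewrite setU11 andbT; apply/idP/andP => [Br|[Br /eqP e]].
    have xB : x \notin B by apply: contra xr => /(subsetP Br).
    split; last by rewrite setU1K.
    apply/subsetP => y; rewrite !inE => /orP[->//|/(subsetP Br)->]; exact: orbT.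
  apply/subsetP => y yB; have := subsetP Br y; rewrite !inE yB orbT => /(_ isT).
  by case/orP => // /eqP yx; move: yB; rewrite -e yx !inE eqxx.
rewrite setU11 /=.
have e (y : T) : y \in r -> (y \in x |: B) = (y \in B).
  by move=> yr; rewrite !inE; case: eqVneq => // yx; rewrite -yx yr in xr.
by congr H; [congr cons|]; apply/eq_in_filter => y yr; rewrite e.
Qed.

End Splits.

Section Shuffles.
Variable n : nat.
Implicit Types (p : 'I_n.+1) (s : 'S_n) (B : {set 'I_n}).

Let lt_ord : rel 'I_n := fun i j => (i < j)%N.

Lemma enum_lt_sorted (P : pred 'I_n) : sorted lt_ord [seq m <- enum 'I_n | P m].
Proof.
apply: sorted_filter; first by move=> i j k; apply: ltn_trans.
suff: sorted ltn (map val (enum 'I_n)) by rewrite sorted_map.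
by rewrite val_enum_ord iota_ltn_sorted.
Qed.

(** A shuffle increases on both blocks, so it is determined by the image of its first block, whose
    cardinality is [p]. *)
Definition head_set p s : {set 'I_n} := [set s m | m in [pred m : 'I_n | (m < p)%N]].

Lemma mem_head_set p s m : (s m \in head_set p s) = (m < p)%N.
Proof. by rewrite mem_imset //; apply: perm_inj. Qed.

Lemma shuffle_head p s : shuffle p s ->
  [seq s m | m : 'I_n <- enum 'I_n & (m < p)%N] = [seq m <- enum 'I_n | m \in head_set p s].
Proof.
move=> /forallP sh; apply: (irr_sorted_eq (leT := lt_ord)).
- by move=> i j k; apply: ltn_trans.
- by move=> i; apply: ltnn.
- apply: (homo_sorted_in (P := [pred m : 'I_n | (m < p)%N]) (e := lt_ord)); last exact: enum_lt_sorted.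
    move=> i j ip jp ij; have /forallP/(_ j) := sh i.
    by rewrite /lt_ord in ij *; rewrite ij (jp : (j < p)%N).
  exact: filter_all.
- exact: enum_lt_sorted.
move=> i; rewrite -(permKV s i) mem_map; last exact: perm_inj.
by rewrite mem_filter [RHS]mem_filter mem_head_set !mem_enum.
Qed.

Lemma shuffle_tail p s : shuffle p s ->
  [seq s m | m : 'I_n <- enum 'I_n & (p <= m)%N] = [seq m <- enum 'I_n | m \notin head_set p s].
Proof.
move=> /forallP sh; apply: (irr_sorted_eq (leT := lt_ord)).
- by move=> i j k; apply: ltn_trans.
- by move=> i; apply: ltnn.
- apply: (homo_sorted_in (P := [pred m : 'I_n | (p <= m)%N]) (e := lt_ord)); last exact: enum_lt_sorted.
    move=> i j ip jp ij; have /forallP/(_ j) := sh i.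
    by rewrite /lt_ord in ij *; rewrite ij (ip : (p <= i)%N) orbT.
  exact: filter_all.
- exact: enum_lt_sorted.
move=> i; rewrite -(permKV s i) mem_map; last exact: perm_inj.
by rewrite mem_filter [RHS]mem_filter mem_head_set !mem_enum -leqNgt.
Qed.

Lemma card_head_set p s : #|head_set p s| = p.
Proof.
rewrite card_imset; last exact: perm_inj.
have pn : (p <= n)%N by rewrite -ltnS.
rewrite -[RHS](card_ord p) -(card_image (f := widen_ord pn)); last first.
  by move=> i j /(congr1 val) /= /val_inj.
apply: eq_card => m; rewrite inE; apply/idP/imageP => [mp|[i _ ->]]; last exact: ltn_ord i.
by exists (Ordinal mp) => //; apply: val_inj.
Qed.

Lemma shuffle_inj p s p' s' : shuffle p s -> shuffle p' s' ->
  head_set p s = head_set p' s' -> (p, s) = (p', s').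
Proof.
move=> sh sh' e.
have pp : p = p' by apply: val_inj; rewrite /= -(card_head_set p s) e card_head_set.
move: sh' e; rewrite -{p'}pp => sh' e; congr pair; apply/permP => m.
have mE (P : pred 'I_n) : [seq s m | m <- enum 'I_n & P m] = [seq s' m | m <- enum 'I_n & P m] ->
    P m -> s m = s' m.
  by move=> /eq_in_map h Pm; apply: h; rewrite mem_filter Pm mem_enum.
have [mp|mp] := leqP p m.
  apply: (mE [pred m : 'I_n | (p <= m)%N]) => //=.
  by rewrite (shuffle_tail sh) e -(shuffle_tail sh').
apply: (mE [pred m : 'I_n | (m < p)%N]) => //=.
by rewrite (shuffle_head sh) e -(shuffle_head sh').
Qed.

Lemma shuffle_surj B : exists p s, shuffle p s /\ head_set p s = B.
Proof.
(* The shuffle sought lists [B] in increasing order, then its complement. *)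
pose l1 := [seq m <- enum 'I_n | m \in B]; pose l2 := [seq m <- enum 'I_n | m \notin B].
have ul : uniq (l1 ++ l2).
  have ue := enum_uniq 'I_n.
  rewrite cat_uniq (filter_uniq _ ue) (filter_uniq _ ue) andbT; apply/hasPn => m.
  by rewrite mem_filter => /andP[/negbTE mB _]; rewrite mem_filter mB.
have sl : size (l1 ++ l2) = n.
  by rewrite size_cat !size_filter -[RHS](size_enum_ord n) -[RHS](count_predC (mem B)).
have f_inj : injective (fun m : 'I_n => nth m (l1 ++ l2) m).
  move=> i j; rewrite (set_nth_default j) ?sl ?ltn_ord // => /eqP.
  by rewrite nth_uniq ?sl ?ltn_ord // => /eqP/val_inj.
have s1 : (size l1 < n.+1)%N by rewrite ltnS -[X in (_ <= X)%N]sl size_cat leq_addr.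
exists (Ordinal s1), (perm f_inj).
have st1 : sorted lt_ord l1 by apply: enum_lt_sorted.
have st2 : sorted lt_ord l2 by apply: enum_lt_sorted.
have lt_tr : transitive lt_ord by move=> i j k; apply: ltn_trans.
split.
  apply/forallP => i; apply/forallP => j; apply/implyP => /andP[ij /orP[jp|pi]] /=; rewrite !permE.
    have ip := ltn_trans ij jp.
    rewrite !nth_cat ip jp (set_nth_default j i ip).
    exact: (sorted_ltn_nth lt_tr j st1).
  have pj : (size l1 <= j)%N := leq_trans pi (ltnW ij).
  rewrite !nth_cat (ltnNge i (size l1)) (ltnNge j (size l1)) pi pj /=.
  have jl : (j - size l1 < size l2)%N by rewrite ltn_subLR // -size_cat sl.
  have il : (i - size l1 < size l2)%N by rewrite ltn_subLR // -size_cat sl.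
  rewrite (set_nth_default j i il).
  by apply: (sorted_ltn_nth lt_tr j st2); rewrite ?inE // ltn_sub2r // (leq_ltn_trans pi).
apply/setP => m; apply/imsetP/idP => [[i ip ->]|mB].
  rewrite permE nth_cat; move: ip; rewrite inE /= => ip; rewrite ip.
  by have := mem_nth i ip; rewrite mem_filter => /andP[].
have ml : m \in l1 by rewrite mem_filter mB mem_enum.
have il : (index m l1 < n)%N.
  by apply: leq_trans (_ : size l1 <= n)%N; rewrite ?index_mem.
exists (Ordinal il); first by rewrite inE /= index_mem.
by rewrite permE nth_cat /= index_mem ml nth_index.
Qed.

Lemma shuffle_coprod_sets (R : pzRingType) (V : zmodType) (x : 'I_n -> R) (t : R -> R -> V) :
  shuffle_coprod x t = \sum_(B : {set 'I_n})
    t (\prod_(m <- [seq m <- enum 'I_n | m \in B]) x m)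
      (\prod_(m <- [seq m <- enum 'I_n | m \notin B]) x m).
Proof.
rewrite /shuffle_coprod pair_big_dep /=.
rewrite (partition_big (fun q => head_set q.1 q.2) predT) //=.
apply: eq_bigr => B _; have [p [s [sh hB]]] := shuffle_surj B.
rewrite (big_pred1 (p, s)) => [|[p' s'] /=].
  have e (P : pred 'I_n) : \prod_(m <- [seq m <- enum 'I_n | P m]) x (s m) =
      \prod_(m < n | P m) x (s m).
    by rewrite big_filter enumT [index_enum _]unlock.
  by rewrite -hB -(shuffle_head sh) -(shuffle_tail sh) !big_map !e.
apply/andP/eqP => [[sh' /eqP e]|[-> ->]]; last by rewrite hB.
by apply: shuffle_inj => //; rewrite e.
Qed.

End Shuffles.

Lemma shuffle_coprod_splits (R : pzRingType) (V : zmodType) n (x : 'I_n -> R)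
    (t : R -> R -> V) :
  shuffle_coprod x t =
  \sum_(p <- splits [seq x m | m <- enum 'I_n]) t (\prod_(y <- p.1) y) (\prod_(y <- p.2) y).
Proof.
rewrite shuffle_coprod_sets.
rewrite sum_splits_map.
rewrite (sum_splits_sets (fun p q => t (\prod_(y <- map x p) y) (\prod_(y <- map x q) y)));
  last exact: enum_uniq.
apply: eq_big => [B|B _]; last by rewrite !big_map.
by apply/esym/subsetP => m _; rewrite mem_enum.
Qed.

(** * Compatibility with the coring structures *)

Lemma index_enum_ord n : index_enum 'I_n = enum 'I_n.
Proof. by rewrite enumT [index_enum _]unlock. Qed.

Section CoringOnWords.
Variables (K : fieldType) (A : comAlgType K) (g : lmodType A).
Variables (R : pzRingType) (iA : {rmorphism A -> R}) (ig : g -> R).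
Hypothesis igZ : forall a X, ig (a *: X) = iA a * ig X.
Variables (T : zmodType) (t : R -> R -> T) (D : {additive R -> T}) (e : {additive R -> A}).
Hypothesis tbal : forall a u v, t (iA a * u) v = t u (iA a * v).
Hypothesis Hc : enveloping_coring iA ig t D e.

Local Notation mon := (mon ig).

Lemma mon_tnth (w : seq g) : mon w = \prod_(m < size w) ig (tnth (in_tuple w) m).
Proof. exact: big_tnth. Qed.

Lemma comult_mon w : D (mon w) = \sum_(p <- splits w) t (mon p.1) (mon p.2).
Proof.
have [D0 Dw _ _] := Hc.
case: (posnP (size w)) => [/size0nil->|sw].
  by rewrite big_seq1 !mon_nil -(rmorph1 iA) D0 rmorph1.
rewrite mon_tnth Dw // shuffle_coprod_splits.
rewrite map_comp (_ : [seq tnth (in_tuple w) i | i <- enum 'I_(size w)] = w).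
  by rewrite sum_splits_map; apply: eq_bigr => p _ /=; rewrite !big_map.
by rewrite -[RHS](map_tnth_enum (in_tuple w)).
Qed.

Lemma mon_scale a X w : iA a * mon (X :: w) = mon (a *: X :: w).
Proof. by rewrite !mon_cons igZ mulrA. Qed.

(** The coproduct is prescribed on products of elements of [g] only, so [a] is absorbed into the
    first letter; where this letter falls in the right factor, balancedness brings [a] back to the
    left. *)
Lemma comult_scale_mon a w :
  D (iA a * mon w) = \sum_(p <- splits w) t (iA a * mon p.1) (mon p.2).
Proof.
case: w => [|X w]; first by have [D0 _ _ _] := Hc; rewrite big_seq1 !mon_nil mulr1 D0.
rewrite mon_scale comult_mon !sum_splits_cons; congr (_ + _).
  by apply: eq_bigr => p _ /=; rewrite mon_scale.
by apply: eq_bigr => p _ /=; rewrite -mon_scale tbal.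
Qed.

Lemma counit_scale_mon a w : e (iA a * mon w) = if w is [::] then a else 0.
Proof.
have [_ _ e0 ew] := Hc; case: w => [|X w]; first by rewrite mon_nil mulr1 e0.
by rewrite mon_scale mon_tnth ew.
Qed.

End CoringOnWords.

Section CoringMorphism.
Variables (K : fieldType) (A : comAlgType K) (g : lmodType A).
Variables (br : g -> g -> g) (om : g -> A -> A).
Hypothesis Hchar : [pchar K] =i pred0.
Hypothesis HLR : LieRinehart br om.
Variables (I : eqType) (chi : I -> g) (phi : I -> g -> A).
Hypothesis Hdb : dual_basis chi phi.
Variables (U : pzRingType) (iA : {rmorphism A -> U}) (ig : g -> U).
Hypothesis HU : is_UEA br om iA ig.
Variables (TU : zmodType) (tU : U -> U -> TU).
Hypothesis HTU : is_tensor (fun (a : A) (u : U) => iA a * u) tU.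
Variables (DU : {additive U -> TU}) (eU : {additive U -> A}).
Hypothesis HcU : enveloping_coring iA ig tU DU eU.
Variables (S : comAlgType A) (jS : {linear g -> S}).
Hypothesis HS : is_SymAlg jS.
Variables (TS : zmodType) (tS : S -> S -> TS).
Hypothesis HTS : is_tensor (fun (a : A) (x : S) => a *: x) tS.
Variables (DS : {additive S -> TS}) (eS : {additive S -> A}).
Hypothesis HcS : enveloping_coring (fun a : A => a%:A) jS tS DS eS.

Notation symU := (sym Hdb iA (fun i => ig (chi i))).
Notation RU := (Rop Hdb iA (fun i => ig (chi i))).
Notation mon := (mon ig).
Notation Sym := (symmetrisation Hchar Hdb iA ig HS).

Lemma tU_balanced : balanced_biadd (fun (a : A) (u : U) => iA a * u) tU.
Proof. by have [] := HTU. Qed.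

Lemma tU_sum_l (J : Type) (r : seq J) (F : J -> U) v :
  tU (\sum_(i <- r) F i) v = \sum_(i <- r) tU (F i) v.
Proof.
have [tl _ _] := tU_balanced; apply: (big_morph (tU^~ v)) => [x y|]; first exact: tl.
by apply: (addIr (tU 0 v)); rewrite -tl !add0r.
Qed.

Lemma tU_sum_r (J : Type) (r : seq J) (F : J -> U) u :
  tU u (\sum_(i <- r) F i) = \sum_(i <- r) tU u (F i).
Proof.
have [_ tr _] := tU_balanced; apply: (big_morph (tU u)) => [x y|]; first exact: tr.
by apply: (addIr (tU u 0)); rewrite -tr !add0r.
Qed.

Lemma mon_ind (P : U -> Prop) : (forall u v, P u -> P v -> P (u + v)) ->
  (forall a w, P (iA a * mon w)) -> forall u, P u.
Proof.
move=> PD Pm u; have [n [v [_ ->]]] := low_exhaustive HU u.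
elim: v => [|p v IH]; last by rewrite big_cons; apply: PD.
by rewrite big_nil; have := Pm 0 [::]; rewrite rmorph0 mul0r.
Qed.

(** The tensor square is given as an abelian group only; its left [A]-action is recovered from the
    universal property. *)
Lemma scale_tensor a : exists L : {additive TU -> TU},
  forall u v, L (tU u v) = tU (iA a * u) v.
Proof.
have [tl tr tb] := tU_balanced.
have [_ /(_ TU (fun u v => tU (iA a * u) v)) []] := HTU; last first.
  by move=> L [hL _]; exists L.
split=> [u1 u2 v|u v1 v2|b u v]; rewrite ?mulrDr ?tl ?tr //.
by rewrite mulrA -rmorphM mulrC rmorphM -mulrA tb.
Qed.

Lemma scale_tensor_comult a (L : {additive TU -> TU}) :
  (forall u v, L (tU u v) = tU (iA a * u) v) ->
  forall u, DU (iA a * u) = L (DU u).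
Proof.
have [_ _ tb] := tU_balanced.
move=> hL; apply: mon_ind => [u v hu hv|b w]; first by rewrite mulrDr !raddfD hu hv.
rewrite mulrA -rmorphM !(comult_scale_mon (igZ HU) tb HcU) raddf_sum.
by apply: eq_bigr => p _; rewrite hL mulrA rmorphM.
Qed.

(** Right multiplication by [chi i] appends a letter, which [sum_splits_rcons] sends to either
    factor; its coefficient follows it there by balancedness. *)
Lemma Rop_comult y : exists Rt : {additive TU -> TU},
  (forall u v, Rt (tU u v) = tU (RU y u) v + tU u (RU y v)) /\
  (forall u, DU (RU y u) = Rt (DU u)).
Proof.
have [tl tr tb] := tU_balanced.
have [_ /(_ TU (fun u v => tU (RU y u) v + tU u (RU y v))) []] := HTU; last first.
  move=> Rt [hR _]; exists Rt; split=> //; apply: mon_ind => [u v hu hv|a w].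
    by rewrite RopD !raddfD hu hv.
  rewrite (comult_scale_mon (igZ HU) tb HcU).
  transitivity (\sum_(i <- supp Hdb y) \sum_(p <- splits w)
     (tU (iA (phi i y) * (iA a * mon p.1) * ig (chi i)) (mon p.2) +
      tU (iA a * mon p.1) (iA (phi i y) * mon p.2 * ig (chi i)))).
    rewrite /Rop raddf_sum; apply: eq_bigr => i _.
    rewrite mulrA -rmorphM -mulrA -mon_rcons (comult_scale_mon (igZ HU) tb HcU).
    rewrite sum_splits_rcons; apply: eq_bigr => p _ /=.
    by rewrite !mon_rcons !rmorphM -!mulrA !tb.
  rewrite exchange_big [RHS]raddf_sum; apply: eq_bigr => p _.
  by rewrite big_split /= hR /Rop tU_sum_l tU_sum_r.
split=> [u1 u2 v|u v1 v2|a u v]; rewrite ?RopD ?tl ?tr ?RopD ?tr ?tl.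
- by rewrite addrACA.
- by rewrite addrACA.
- by rewrite !RopA !tb.
Qed.

(** Inherited from the commutativity of [S] through the well-defined map [Sym]. *)
Lemma symU_perm w w' : perm_eq w w' -> symU w = symU w'.
Proof.
move=> ww; rewrite -!(symmetrisation_prod Hchar Hdb iA ig HS) //.
by rewrite (perm_big _ ww).
Qed.

Lemma symU_rec w : \sum_(y <- w) RU y (symU (rem y w)) = iA (size w)%:R * symU w.
Proof.
case: (posnP (size w)) => [/size0nil->|sw]; first by rewrite big_nil rmorph0 mul0r.
rewrite symE -?size_eq0 -?lt0n // mulrA -rmorphM mulrC nat_invK //.
by rewrite rmorph1 mul1r.
Qed.

Lemma comult_symU w : DU (symU w) = \sum_(p <- splits w) tU (symU p.1) (symU p.2).
Proof.
have [tl tr tb] := tU_balanced.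
have [n] := ubnP (size w); elim: n w => // n IH w sw.
case: (posnP (size w)) => [/size0nil->|w0].
  by have [D0 _ _ _] := HcU; rewrite big_seq1 !sym0 -(rmorph1 iA) D0 rmorph1.
have [L hL] := scale_tensor (nat_inv A (size w)).
rewrite symE -?size_eq0 -?lt0n // (scale_tensor_comult hL).
suff -> : DU (\sum_(y <- w) RU y (symU (rem y w))) =
    \sum_(p <- splits w) tU (iA (size w)%:R * symU p.1) (symU p.2).
  rewrite raddf_sum; apply: eq_bigr => p _.
  by rewrite hL mulrA -rmorphM nat_invK // rmorph1 mul1r.
transitivity (\sum_(y <- w) \sum_(p <- splits (rem y w))
    (tU (RU y (symU p.1)) (symU p.2) + tU (symU p.1) (RU y (symU p.2)))).
  rewrite raddf_sum; apply: eq_big_seq => y yw.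
  have [Rt [hR hD]] := Rop_comult y.
  rewrite hD IH; last by rewrite -ltnS size_remS.
  by rewrite raddf_sum; apply: eq_bigr => p _; rewrite hR.
under eq_bigr => y _ do rewrite big_split.
rewrite big_split /=.
rewrite -(@sum_splits_rem_l _ _ w (fun y p q => tU (RU y (symU p)) (symU q))); last first.
  by move=> y p p' q q' ep eq; rewrite (symU_perm ep) (symU_perm eq).
rewrite -(@sum_splits_rem_r _ _ w (fun y p q => tU (symU p) (RU y (symU q)))); last first.
  by move=> y p p' q q' ep eq; rewrite (symU_perm ep) (symU_perm eq).
rewrite -big_split; apply: eq_big_seq => p pw /=.
(* The recursion multiplies the two factors by the lengths of their subwords, which add up to
   [size w]. *)
rewrite -tU_sum_l -tU_sum_r !symU_rec -tb -tl -mulrDl -rmorphD -natrD.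
by rewrite (size_splits pw).
Qed.

Lemma symS_ind (P : S -> Prop) : (forall x y, P x -> P y -> P (x + y)) ->
  (forall a w, P (a *: \prod_(y <- w) jS y)) -> forall x, P x.
Proof.
move=> PD Pm x; have [v ->] := symS_span Hchar Hdb HS x.
rewrite /ev; elim: v => [|p v IH].
  by rewrite big_nil; have := Pm 0 [::]; rewrite scale0r.
by rewrite big_cons; apply: PD => //; rewrite symS_prod //= mulr_algl.
Qed.

Lemma tS_balanced a u v : tS (in_alg S a * u) v = tS u (in_alg S a * v).
Proof. by have [[_ _ tb] _] := HTS; rewrite /= !mulr_algl tb. Qed.

Lemma jS_scale a X : jS (a *: X) = in_alg S a * jS X.
Proof. by rewrite linearZ /= mulr_algl. Qed.

Lemma symmetrisation_tensor : exists F : {additive TS -> TU},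
  (forall x y, F (tS x y) = tU (Sym x) (Sym y)) /\
  (forall x, DU (Sym x) = F (DS x)).
Proof.
have [tl tr tb] := tU_balanced.
have SD := symmetrisationD Hchar Hdb iA ig HS.
have SZ := symmetrisationZ Hchar Hdb iA ig HS.
have SP := symmetrisation_prod Hchar Hdb iA ig HS.
have [_ /(_ TU (fun x y => tU (Sym x) (Sym y))) []] := HTS; last first.
  move=> F [hF _]; exists F; split=> //.
  apply: symS_ind => [x y hx hy|a w]; first by rewrite SD !raddfD hx hy.
  have [L hL] := scale_tensor a.
  rewrite SZ SP (scale_tensor_comult hL) comult_symU -mulr_algl.
  rewrite (comult_scale_mon (iA := in_alg S) jS_scale tS_balanced HcS).
  rewrite !raddf_sum; apply: eq_bigr => p _ /=.
  by rewrite hL hF mulr_algl SZ !SP.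
by split=> [x y z|x y z|a x y]; rewrite ?SD ?SZ ?tl ?tr ?tb.
Qed.

Lemma symmetrisation_counit x : eU (Sym x) = eS x.
Proof.
have SD := symmetrisationD Hchar Hdb iA ig HS.
have SZ := symmetrisationZ Hchar Hdb iA ig HS.
have SP := symmetrisation_prod Hchar Hdb iA ig HS.
move: x; apply: symS_ind => [x y hx hy|a w]; first by rewrite SD !raddfD hx hy.
rewrite SZ SP -mulr_algl (counit_scale_mon (iA := in_alg S) jS_scale HcS).
case: w => [|X w]; first by rewrite sym0 mulr1; have [_ _ -> _] := HcU.
(* Every term of [symU] on a nonempty word ends with a letter, and the counit kills such
   elements. *)
have eX u Y : eU (u * ig Y) = 0.
  move: u; apply: mon_ind => [u v hu hv|b t]; first by rewrite mulrDl raddfD /= hu hv addr0.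
  by rewrite -mulrA -mon_rcons (counit_scale_mon (igZ HU) HcU); case: t.
rewrite symE // mulrA -rmorphM mulr_sumr raddf_sum big1 // => y _.
by rewrite /Rop mulr_sumr raddf_sum big1 // => i _; rewrite mulrA eX.
Qed.

End CoringMorphism.

(** * The symmetrisation formula *)

Section OrdinalSums.
Variable V : nmodType.

Lemma sum_ffun_recr n (T : finType) (G : {ffun 'I_n.+1 -> T} -> V) :
  \sum_J G J =
  \sum_(J : {ffun 'I_n -> T}) \sum_(t : T)
    G [ffun i => if unlift ord_max i is Some j then J j else t].
Proof.
rewrite pair_bigA /=.
rewrite (reindex (fun q : {ffun 'I_n -> T} * T =>
  [ffun i => if unlift ord_max i is Some j then q.1 j else q.2])) //=.
exists (fun J => ([ffun j => J (lift ord_max j)], J ord_max)) => [[J t] _|J _] /=.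
  by congr pair; [apply/ffunP => j; rewrite !ffunE liftK | rewrite ffunE unlift_none].
by apply/ffunP => i; rewrite !ffunE; case: unliftP => [j|] ->; rewrite ?ffunE.
Qed.

Lemma sum_perm_recr n (G : 'S_n.+1 -> V) :
  \sum_s G s = \sum_(j < n.+1) \sum_(s : 'S_n) G (lift_perm ord_max j s).
Proof.
rewrite pair_bigA /= (reindex (fun q : 'I_n.+1 * 'S_n => lift_perm ord_max q.1 q.2)) //=.
apply: onW_bij; apply: inj_card_bij.
  move=> [j s] [j' s'] /= e.
  have jj : j = j' by rewrite -(lift_perm_id ord_max j s) e lift_perm_id.
  rewrite -{j'}jj in e *; congr pair; apply/permP => i; apply: (@lift_inj _ j).
  by rewrite -!(lift_perm_lift ord_max) e.
by rewrite card_prod card_ord !card_Sn factS.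
Qed.

End OrdinalSums.

Section SymmetrisationFormula.
Variables (K : fieldType) (A : comAlgType K) (g : lmodType A).
Hypothesis Hchar : [pchar K] =i pred0.
Variables (I : eqType) (chi : I -> g) (phi : I -> g -> A).
Hypothesis Hdb : dual_basis chi phi.
Variables (U : pzRingType) (iA : {rmorphism A -> U}) (ig : g -> U).
Variables (S : comAlgType A) (jS : {linear g -> S}).
Hypothesis HS : is_SymAlg jS.

Notation symU := (sym Hdb iA (fun i => ig (chi i))).
Notation RU := (Rop Hdb iA (fun i => ig (chi i))).
Notation Sym := (symmetrisation Hchar Hdb iA ig HS).

(* [X_1 ... X_n] is sent to [\sum_J \prod_m phi_(J m)(X_m) chi_(J 1) ... chi_(J n)]. *)
Definition unsym (w : seq g) : U := foldl (fun u y => RU y u) 1 w.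

Lemma unsym_rcons w y : unsym (rcons w y) = RU y (unsym w).
Proof. by rewrite /unsym foldl_rcons. Qed.

Lemma map_enum_recr (T : Type) n (X : 'I_n.+1 -> T) :
  [seq X m | m <- enum 'I_n.+1] =
  rcons [seq X (lift ord_max m) | m <- enum 'I_n] (X ord_max).
Proof.
rewrite enum_ordSr map_rcons -map_comp; congr (rcons _ _); apply: eq_map => m /=.
by congr X; apply: val_inj; rewrite [RHS]lift_max.
Qed.

Lemma prod_ord_recr (R : pzRingType) n (F : 'I_n.+1 -> R) :
  \prod_(m < n.+1) F m = (\prod_(m < n) F (lift ord_max m)) * F ord_max.
Proof.
rewrite big_ord_recr; congr (_ * _); apply: eq_bigr => m _; congr F.
by apply: val_inj; rewrite [RHS]lift_max.
Qed.

Section FixedCover.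
Variable s : seq I.
Hypothesis us : uniq s.
Let c := tnth (in_tuple s).

Lemma unsym_formula n (Y : 'I_n -> g) : (forall m, covers phi s (Y m)) ->
  \sum_(J : {ffun 'I_n -> 'I_(size s)})
     iA (\prod_(m < n) phi (c (J m)) (Y m)) * \prod_(m < n) ig (chi (c (J m))) =
  unsym [seq Y m | m <- enum 'I_n].
Proof.
elim: n Y => [|n IH] Y cY.
  rewrite (big_pred1 (ffun0 (card_ord 0))).
    rewrite !big_ord0 rmorph1 mulr1 (_ : enum 'I_0 = [::]) //.
    by apply: size0nil; rewrite size_enum_ord.
  by move=> J; apply/esym/eqP/ffunP; case.
rewrite map_enum_recr unsym_rcons -IH; last by move=> m; apply: cY.
rewrite sum_ffun_recr (RopE _ _ _ _ us (cY _)) (big_tnth _ _ s) exchange_big /=.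
apply: eq_bigr => i _; rewrite mulr_sumr mulr_suml; apply: eq_bigr => J _.
rewrite !prod_ord_recr !ffunE unlift_none.
rewrite (eq_bigr (fun m => phi (c (J m)) (Y (lift ord_max m)))); last first.
  by move=> m _; rewrite ffunE liftK.
rewrite [X in _ * (X * _)](eq_bigr (fun m => ig (chi (c (J m))))); last first.
  by move=> m _; rewrite ffunE liftK.
by rewrite mulrC rmorphM !mulrA.
Qed.

End FixedCover.

(** Permutations are grouped by the letter [X j] they place last; each group symmetrises the
    remaining letters, as in the recursion of [sym]. *)
Lemma sum_unsym n (X : 'I_n -> g) :
  \sum_(s : 'S_n) unsym [seq X (s m) | m <- enum 'I_n] =
  iA (n`!)%:R * symU [seq X m | m <- enum 'I_n].
Proof.
elim: n X => [|n IH] X.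
  have e0 : enum 'I_0 = [::] by apply: size0nil; rewrite size_enum_ord.
  rewrite e0 /= rmorph1 mulr1 (big_pred1 1%g) // => s.
  by apply/esym/eqP/permP; case.
set w := [seq X m | m <- enum 'I_n.+1].
rewrite sum_perm_recr.
transitivity (\sum_(j < n.+1) iA (n`!)%:R * RU (X j) (symU (rem (X j) w))).
  apply: eq_bigr => j _.
  transitivity (\sum_(s : 'S_n) RU (X j) (unsym [seq X (lift j (s m)) | m <- enum 'I_n])).
    apply: eq_bigr => s _; rewrite map_enum_recr unsym_rcons lift_perm_id.
    by under eq_map do rewrite lift_perm_lift.
  have R0 : RU (X j) 0 = 0 by rewrite /Rop big1 // => i _; rewrite mulr0 mul0r.
  rewrite -(big_morph _ (RopD Hdb iA _ (X j)) R0) (IH (fun i => X (lift j i))) RopA.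
  (* Omitting position [j] and removing the first letter equal to [X j] give the same word up to
     order. *)
  congr (_ * RU _ _); apply: (symU_perm Hchar Hdb iA ig HS).
  rewrite -(perm_cons (X j)) perm_sym.
  have Xw : X j \in w by apply: map_f; rewrite mem_enum.
  rewrite -(permPl (perm_to_rem Xw)).
  have -> : X j :: [seq X (lift j m) | m <- enum 'I_n] =
    [seq X m | m <- j :: [seq lift j m | m <- enum 'I_n]] by rewrite /= -map_comp.
  apply: perm_map; apply: uniq_perm; first exact: enum_uniq.
    rewrite /= map_inj_uniq ?enum_uniq ?andbT; last exact: lift_inj.
    by apply/mapP => -[m _ e]; have := neq_lift j m; rewrite -e eqxx.
  move=> m; rewrite mem_enum [RHS]inE; case: (unliftP j m) => [i ->|->]; last by rewrite eqxx.
  by rewrite map_f ?orbT // mem_enum.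
rewrite -mulr_sumr.
transitivity (iA (n`!)%:R * \sum_(y <- w) RU y (symU (rem y w))).
  by congr (_ * _); rewrite [RHS]big_map index_enum_ord.
rewrite symU_rec // mulrA -rmorphM -natrM size_map size_enum_ord.
by rewrite factS mulnC.
Qed.

Lemma symmetrisation_formula : symm_formula chi phi iA ig jS Sym.
Proof.
move=> k X s k0 us cs; rewrite -/(nat_inv A k`!).
have -> : \prod_(m < k) jS (X m) = \prod_(y <- [seq X m | m <- enum 'I_k]) jS y.
  by rewrite big_map -index_enum_ord.
rewrite symmetrisation_prod exchange_big /=.
transitivity (iA (nat_inv A k`!) * \sum_(s : 'S_k) unsym [seq X (s m) | m <- enum 'I_k]).
  by rewrite sum_unsym mulrA -rmorphM nat_invK ?fact_gt0 // rmorph1 mul1r.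
congr (_ * _); apply: eq_bigr => sg _.
rewrite -(unsym_formula us (Y := fun m => X (sg m))); last by move=> m i; apply: cs.
(* Replacing [J] by its composite with [sg] trades the permutation of the arguments [X] for a
   permutation of the factors [chi]. *)
rewrite (reindex (fun J : {ffun 'I_k -> 'I_(size s)} => [ffun m => J (sg m)])) /=.
  apply: eq_bigr => J _; congr (iA _ * _).
    rewrite [RHS](reindex_perm sg); apply: eq_bigr => m _; by rewrite ffunE.
  by apply: eq_bigr => m _; rewrite ffunE.
exists (fun J : {ffun 'I_k -> 'I_(size s)} => [ffun m => J ((sg^-1)%g m)]) => J _.
  by apply/ffunP => m; rewrite !ffunE permKV.
by apply/ffunP => m; rewrite !ffunE permK.
Qed.

End SymmetrisationFormula.

Theorem theorem1p6 (K : fieldType) (A : comAlgType K) (g : lmodType A)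
    (br : g -> g -> g) (om : g -> A -> A)
    (Hchar : [pchar K] =i pred0)
    (HLR : LieRinehart br om)
    (I : eqType) (chi : I -> g) (phi : I -> g -> A)
    (Hdb : dual_basis chi phi)
    (U : pzRingType) (iA : {rmorphism A -> U}) (ig : g -> U)
    (HU : is_UEA br om iA ig)
    (TU : zmodType) (tU : U -> U -> TU)
    (HTU : is_tensor (fun (a : A) (u : U) => iA a * u) tU)
    (DU : {additive U -> TU}) (eU : {additive U -> A})
    (HcU : enveloping_coring iA ig tU DU eU)
    (S : comAlgType A) (jS : {linear g -> S})
    (HS : is_SymAlg jS)
    (TS : zmodType) (tS : S -> S -> TS)
    (HTS : is_tensor (fun (a : A) (x : S) => a *: x) tS)
    (DS : {additive S -> TS}) (eS : {additive S -> A})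
    (HcS : enveloping_coring (fun a : A => a%:A) jS tS DS eS) :
  exists Sym : S -> U,
    [/\ (forall x y, Sym (x + y) = Sym x + Sym y) /\
          (forall (a : A) x, Sym (a *: x) = iA a * Sym x),
        forall a : A, Sym (a%:A) = iA a,
        symm_formula chi phi iA ig jS Sym,
        bijective Sym &
        (exists F : {additive TS -> TU},
          (forall x y, F (tS x y) = tU (Sym x) (Sym y)) /\
          (forall x, DU (Sym x) = F (DS x))) /\
        (forall x, eU (Sym x) = eS x)].

Proof.
exists (symmetrisation Hchar Hdb iA ig HS); split.
- by split=> [x y|a x]; [apply: symmetrisationD | apply: symmetrisationZ].
- move=> a; have -> : a%:A = a *: \prod_(y <- [::]) jS y by rewrite big_nil.
  by rewrite symmetrisationZ symmetrisation_prod sym0 mulr1.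
- exact: symmetrisation_formula.
- exact: (symmetrisation_bij Hchar HLR Hdb HU HS).
- split; first exact: (symmetrisation_tensor Hchar Hdb HU HTU HcU HS HTS HcS).
  exact: (symmetrisation_counit Hchar Hdb HU HcU HS HcS).
Qed.
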